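(* Let $M=\left(\begin{smallmatrix}1&1\\1&0\end{smallmatrix}\right)$ and $\mathbb T=\mathbb R/\mathbb Z$. The linear action of $M$ induces an expansive homeomorphism on $\mathbb T^2$. This dynamical system is SFT/SFT, namely conjugate to $X/K$ with the shift action, where $X\subset\{0,1\}^{\mathbb Z}$ is the SFT with set of minimal forbidden patterns $\{11\}$, and $K\subset X^2$ is the relation consisting of exactly those pairs in $X^2$ in which none of the following patterns occurs; these are the minimal forbidden patterns of $K$ (other than the length-two patterns expressing that both components belong to $X$): Length 4: 01.10.00.11, 10.01.00.11, 11.00.01.00, 11.00.10.00. Length 5: 00.00.00.01.00, 00.00.00.10.00, 00.00.01.00.00, 00.00.01.00.10, 00.00.01.00.11, 00.00.01.10.01, 00.00.10.00.00, 00.00.10.00.01, 00.00.10.00.11, 00.00.10.01.10, 00.01.00.10.00, 00.01.10.00.00, 00.01.10.00.01, 00.01.10.01.10, 00.10.00.01.00, 00.10.01.00.00, 00.10.01.00.10, 00.10.01.10.01, 01.00.00.01.00, 01.00.01.00.00, 01.00.01.00.10, 01.00.01.00.11, 01.00.01.10.01, 01.10.00.00.00, 01.10.00.00.10, 01.10.00.00.11, 01.10.00.10.01, 10.00.00.10.00, 10.00.10.00.00, 10.00.10.00.01, 10.00.10.00.11, 10.00.10.01.10, 10.01.00.00.00, 10.01.00.00.01, 10.01.00.00.11, 10.01.00.01.10, 11.00.00.01.00, 11.00.00.10.00, 11.00.01.10.01, 11.00.10.01.10. Length 6: 00.00.01.00.01.10, 00.00.10.00.10.01, 00.01.00.00.10.00,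 00.01.00.10.01.10, 00.01.10.01.00.00, 00.01.10.01.00.10, 00.10.00.00.01.00, 00.10.00.01.10.01, 00.10.01.10.00.00, 00.10.01.10.00.01, 01.00.01.00.01.10, 01.00.10.00.10.00, 01.10.00.00.01.10, 01.10.00.01.10.00, 01.10.01.10.00.10, 10.00.01.00.01.00, 10.00.10.00.10.01, 10.01.00.00.10.01, 10.01.00.10.01.00, 10.01.10.01.00.01.
   Context: A homeomorphism $f$ of a compact metric space is expansive if there is $\epsilon>0$ such that for distinct $x,y$ there is $n\in\mathbb Z$ with $d(f^n(x),f^n(y))>\epsilon$. The shift on $\Sigma^{\mathbb Z}$ is $\sigma(x)_i=x_{i+1}$; an SFT is a subshift defined by a finite set of forbidden words. $(\{0,1\}^2)^{\mathbb Z}$ is identified with $\{0,1\}^{\mathbb Z}\times\{0,1\}^{\mathbb Z}$. $X/K$ is the topological quotient of $X$ by the equivalence relation $K$ with the homeomorphism induced by $\sigma$; conjugate means equivariantly homeomorphic; SFT/SFT means conjugate to such a quotient with $X$ an SFT and $K=Z\cap X^2$ for an SFT $Z$. Patterns of $K$ are words over $\{0,1\}^2$, written with letters separated by dots: the pattern $a_1b_1.a_2b_2.\cdots.a_kb_k$ occurs in $(x,y)$ if for some $i\in\mathbb Z$ we have $x_{i+j}=a_j$ and $y_{i+j}=b_j$ for all $1\le j\le k$. A forbidden pattern is minimal if none of its proper subwords is forbidden. *)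

(* Defs.v *)
From HB Require Import structures.
From mathcomp Require Import all_boot all_order all_algebra.
From mathcomp Require Import all_classical all_reals all_analysis.
From mathcomp Require Import ring.

Set Implicit Arguments.
Unset Strict Implicit.
Unset Printing Implicit Defensive.

Import Order.TTheory GRing.Theory Num.Theory.
Import numFieldNormedType.Exports.

Local Open Scope classical_set_scope.
Local Open Scope ring_scope.
Local Open Scope quotient_scope.

(* The predicate underlying the qualifier [Num.int]: Z as a subgroup of R. *)
Definition int_subgroup (R : realType) : zmodClosed R :=
  GRing.ZmodClosed.clone R (@Num.int_num_subdef R) _.

Definition circle (R : realType) : Type :=
  quotient_topology (Quotient.quot (int_subgroup R)).

HB.instance Definition _ (R : realType) := Topological.on (circle R).
HB.instance Definition _ (R : realType) := Quotient.on (circle R).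
HB.instance Definition _ (R : realType) :=
  GRing.Zmodule.copy (circle R) (Quotient.quot (int_subgroup R)).

Section Circle.
Variable R : realType.
Implicit Types x y z : R.

(* Distance from x to the nearest integer. *)
Definition dist_int x : R :=
  Num.min (x - (Num.floor x)%:~R) ((Num.ceil x)%:~R - x).

(* The quotient metric of R/Z: distance between the two classes in R. *)
Definition circle_dist (a b : circle R) : R := dist_int (repr a - repr b).

Lemma circle_piP x y :
  (exists n : int, x - y = n%:~R) <-> \pi_(circle R) x = \pi_(circle R) y.
Proof.
have -> : (\pi_(circle R) x = \pi_(circle R) y) <-> x - y \in int_subgroup R.
  by rewrite Quotient.idealrBE; split=> [->//|/eqP].
by split=> [|] /Num.Theory.intrP.
Qed.

Lemma circle_piD x y :
  \pi_(circle R) (x + y) = \pi_(circle R) x + \pi_(circle R) y.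
Proof. exact: (raddfD (\pi_(Quotient.quot (int_subgroup R)))). Qed.

Lemma circle_piMz x (n : int) : \pi_(circle R) (n%:~R * x) = \pi x *~ n.
Proof.
rewrite mulrzl; exact: (raddfMz (\pi_(Quotient.quot (int_subgroup R)))).
Qed.

Lemma dist_int_le x (n : int) : dist_int x <= `|x - n%:~R|.
Proof.
rewrite /dist_int ge_min; case: (lerP n%:~R x) => nx.
  by rewrite lerB// ler_int floor_ge_int.
by apply/orP; right; rewrite lerB// ler_int ceil_le_int ltW.
Qed.

Lemma dist_int_attained x : exists n : int, dist_int x = `|x - n%:~R|.
Proof.
rewrite /dist_int; have [_|_] := leP (x - (Num.floor x)%:~R).
  by exists (Num.floor x); rewrite ger0_norm// subr_ge0 floor_le.
by exists (Num.ceil x); rewrite distrC ger0_norm// subr_ge0 ceil_ge.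
Qed.

Lemma circle_distP (a b : circle R) (e : R) : circle_dist a b < e <->
  exists x y, [/\ \pi_(circle R) x = a, \pi_(circle R) y = b & `|x - y| < e].
Proof.
split=> [|[x [y [<- <- xy]]]].
  rewrite /circle_dist; have [n ->] := dist_int_attained (repr a - repr b).
  exists (repr a), (repr b + n%:~R); split; rewrite ?reprK//.
    rewrite -[RHS]reprK; apply/circle_piP; exists n.
    by rewrite addrAC subrr add0r.
  by rewrite opprD addrA.
have [m Em] : exists m : int, repr (\pi_(circle R) x) - x = m%:~R.
  by apply/circle_piP; rewrite reprK.
have [n En] : exists n : int, repr (\pi_(circle R) y) - y = n%:~R.
  by apply/circle_piP; rewrite reprK.
apply: le_lt_trans xy.
apply: le_trans (dist_int_le _ (m - n)) _.
by rewrite intrB -Em -En le_eqVlt; apply/orP; left; apply/eqP; congr `|_|; ring.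
Qed.

Lemma circle_dist_ge0 a b : 0 <= circle_dist a b.
Proof.
by rewrite /circle_dist; have [n ->] := dist_int_attained (repr a - repr b).
Qed.

Lemma circle_dist_eq0 a b : circle_dist a b = 0 -> a = b.
Proof.
rewrite /circle_dist; have [n ->] := dist_int_attained (repr a - repr b).
move/normr0_eq0/eqP; rewrite subr_eq0 => /eqP abn.
by rewrite -[a]reprK -[b]reprK; apply/circle_piP; exists n.
Qed.

Definition circle_ball (a : circle R) (e : R) : set (circle R) :=
  [set b | circle_dist a b < e].

Lemma circle_ball_center a e : 0 < e -> circle_ball a e a.
Proof.
move=> e0; apply/circle_distP; exists (repr a), (repr a).
by rewrite reprK subrr normr0.
Qed.

Lemma circle_ball_sym a b e : circle_ball a e b -> circle_ball b e a.
Proof.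
move=> /circle_distP[x [y [xa yb xy]]]; apply/circle_distP; exists y, x.
by rewrite distrC.
Qed.

Lemma circle_ball_triangle a b c e1 e2 :
  circle_ball a e1 b -> circle_ball b e2 c -> circle_ball a (e1 + e2) c.
Proof.
move=> /circle_distP[x [y [xa yb xy]]] /circle_distP[y' [z [yb' zc yz]]].
have [n En] : exists n : int, y - y' = n%:~R.
  by apply/circle_piP; rewrite yb.
apply/circle_distP; exists x, (z + n%:~R); split=> //.
  by rewrite -zc; apply/circle_piP; exists n; rewrite addrAC subrr add0r.
have -> : x - (z + n%:~R) = (x - y) + (y' - z) by rewrite -En; ring.
exact: le_lt_trans (ler_normD _ _) (ltrD xy yz).
Qed.

Lemma circle_nbhsE : @nbhs _ (circle R) = nbhs_ (entourage_ circle_ball).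
Proof.
apply/funext => a; apply/seteqP; split=> U.
  rewrite nbhsE /= => -[V [oV Va] VU].
  have /nbhs_ballP[e /= e0 eV] : nbhs (repr a) (\pi_(circle R) @^-1` V).
    by apply: open_nbhs_nbhs; split; [exact: oV|rewrite /= reprK].
  exists [set ab | circle_ball ab.1 e ab.2]; first by exists e.
  move=> b /xsectionP /= /circle_distP[x [y [xa yb xy]]]; apply: VU.
  have [n En] : exists n : int, repr a - x = n%:~R.
    by apply/circle_piP; rewrite reprK.
  have <- : \pi_(circle R) (y + n%:~R) = b.
    by rewrite -yb; apply/circle_piP; exists n; rewrite addrAC subrr add0r.
  apply: eV; rewrite /ball /= -En.
  by have -> : repr a - (y + (repr a - x)) = x - y by ring.
case=> E [e /= e0 eE] EU.
rewrite nbhsE /=; exists (circle_ball a e); last first.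
  by move=> b ab; apply/EU/xsectionP/eE.
split; last exact: circle_ball_center.
rewrite /open /= /quotient_open openE => y /= /circle_distP[x [z [xa zy xz]]].
apply/nbhs_ballP; exists (e - `|x - z|); first by rewrite /= subr_gt0.
move=> t; rewrite /ball /= ltrBrDl => yt; apply/circle_distP.
have [n En] : exists n : int, y - z = n%:~R by apply/circle_piP; rewrite zy.
exists x, (t - (y - z)); split=> //.
  by apply/circle_piP; exists (- n); rewrite En intrN; ring.
have -> : x - (t - (y - z)) = (x - z) + (y - t) by ring.
exact: le_lt_trans (ler_normD _ _) yt.
Qed.

HB.instance Definition _ := @Nbhs_isPseudoMetric.Build R (circle R)
  (entourage_ circle_ball) circle_nbhsE circle_ball circle_ball_center
  circle_ball_sym circle_ball_triangle erefl.
HB.instance Definition _ := @Uniform_isPseudoMetric.Build R (circle R)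
  circle_ball circle_ball_center circle_ball_sym circle_ball_triangle erefl.
HB.instance Definition _ := @PseudoMetric_isMetric.Build R (circle R)
  circle_dist circle_dist_ge0 circle_dist_eq0 (fun _ _ => erefl).

End Circle.

Section ProdMetric.
Variables (R : realFieldType) (U V : metricType R).
Implicit Types p q : U * V.

Definition prod_dist p q : R :=
  Num.max (mdist p.1 q.1) (mdist p.2 q.2).

Lemma prod_dist_ge0 p q : 0 <= prod_dist p q.
Proof. by rewrite le_max mdist_ge0. Qed.

Lemma prod_dist_eq0 p q : prod_dist p q = 0 -> p = q.
Proof.
move=> pq0; have : prod_dist p q <= 0 by rewrite pq0.
rewrite ge_max => /andP[p1 p2]; case: p q p1 p2 {pq0} => a b [c d] /= p1 p2.
by congr pair; apply/mdist_positivity/eqP; rewrite eq_le mdist_ge0 andbT.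
Qed.

Lemma ball_prod_distE p (e : R) : ball p e = [set q | prod_dist p q < e].
Proof.
apply/seteqP; split=> q; rewrite /= gt_max /ball /= /prod_ball !ballEmdist /=.
  by move=> [-> ->].
by move=> /andP[].
Qed.

HB.instance Definition _ := @PseudoMetric_isMetric.Build R (U * V)%type
  prod_dist prod_dist_ge0 prod_dist_eq0 ball_prod_distE.

End ProdMetric.

Section Torus.
Variable R : realType.

Definition torus : Type := (circle R * circle R)%type.
HB.instance Definition _ := Metric.on torus.

Definition torus_pi (v : 'cV[R]_2) : torus :=
  (\pi_(circle R) (v 0 0), \pi_(circle R) (v 1 0)).

Definition torus_map (A : 'M[int]_2) (p : torus) : torus :=
  (p.1 *~ A 0 0 + p.2 *~ A 0 1, p.1 *~ A 1 0 + p.2 *~ A 1 1).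

Lemma torus_map_pi (A : 'M[int]_2) (v : 'cV[R]_2) :
  torus_map A (torus_pi v) = torus_pi (map_mx intr A *m v).
Proof.
rewrite /torus_map /torus_pi /= !mxE !big_ord_recl !big_ord0 !addr0 !mxE.
rewrite !circle_piD !circle_piMz.
have -> : lift (0 : 'I_2) 0 = 1 :> 'I_2 by apply/val_inj.
by [].
Qed.

End Torus.

Definition homeomorphism (T U : topologicalType) (f : T -> U) : Prop :=
  exists g : U -> T,
    [/\ cancel f g, cancel g f, continuous f & continuous g].

Definition conjugate (T U : topologicalType) (f : T -> T) (g : U -> U) :
    Prop :=
  exists2 h : T -> U, homeomorphism h & forall x, h (f x) = g (h x).

(* f^n for n : int, where g is the inverse of f. *)
Definition iterz (T : Type) (f g : T -> T) (n : int) : T -> T :=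
  match n with Posz k => iter k f | Negz k => iter k.+1 g end.

Definition expansive (R : realType) (T : metricType R) (f : T -> T) : Prop :=
  compact [set: T] /\
  exists g : T -> T,
    [/\ cancel f g, cancel g f, continuous f, continuous g &
     exists2 eps : R, 0 < eps &
       forall x y, x <> y ->
         exists n : int, eps < mdist (iterz f g n x) (iterz f g n y)].

Definition full_shift (S : finType) : Type :=
  prod_topology (fun _ : int => discrete_topology S).
HB.instance Definition _ (S : finType) := Topological.copy (full_shift S)
  (prod_topology (fun _ : int => discrete_topology S)).

Section Subshifts.
Variable S : finType.
Implicit Types (x : full_shift S) (u w : seq S).

Definition shift x : full_shift S := fun i => x (i + 1).

Definition occurs w x : Prop :=
  exists i : int, w = mkseq (fun j : nat => x (i + j%:Z)) (size w).

Definition sft (F : seq (seq S)) : set (full_shift S) :=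
  [set x | forall w, w \in F -> ~ occurs w x].

Definition forbidden (X : set (full_shift S)) w : Prop :=
  forall x, X x -> ~ occurs w x.

Definition minimal_forbidden (X : set (full_shift S)) : set (seq S) :=
  [set w | forbidden X w /\
     forall u, infix u w -> u != w -> ~ forbidden X u].

Lemma sft_shift (F : seq (seq S)) x : sft F x -> sft F (shift x).
Proof.
move=> Fx w wF [i Ew]; apply: (Fx w wF); exists (i + 1).
by rewrite [LHS]Ew; apply: eq_mkseq => j; rewrite /shift addrAC.
Qed.

Definition sft_map (F : seq (seq S)) (x : sft F) : sft F :=
  SigSub (mem_set (sft_shift (set_valP x))).

End Subshifts.

(* The identification of S^Z x S^Z with (S x S)^Z. *)
Definition pairing (S : finType) (x y : full_shift S) :
  full_shift (S * S)%type := fun i => (x i, y i).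

Definition square (S : finType) (X : set (full_shift S)) :
    set (full_shift (S * S)%type) :=
  [set z | exists x y, [/\ X x, X y & z = pairing x y]].

(* K is an equivalence relation on the SFT X given by F, and f is conjugate to
   X/K, where g is the homeomorphism of X/K induced by the shift. *)
Definition quotient_conjugate (T : topologicalType) (f : T -> T)
    (S : finType) (F : seq (seq S)) (K : set (full_shift (S * S)%type)) :
    Prop :=
  exists e : equiv_rel (sft F),
    (forall x y : sft F, e x y <-> K (pairing (\val x) (\val y))) /\
    exists g : quotient_topology {eq_quot e} -> quotient_topology {eq_quot e},
      [/\ homeomorphism g,
          forall x : sft F,
            g (\pi_(quotient_topology {eq_quot e}) x) =
            \pi_(quotient_topology {eq_quot e}) (sft_map x) &
          conjugate f g].

Definition SFT_SFT (T : topologicalType) (f : T -> T) : Prop :=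
  exists (S : finType) (F : seq (seq S)) (G : seq (seq (S * S)%type)),
    quotient_conjugate f F (sft G `&` square (sft F)).

Definition fib_mx : 'M[int]_2 :=
  \matrix_(i, j) nth 0 (nth [::] [:: [:: 1; 1]; [:: 1; 0]] i) j.

Definition golden_mean_words : seq (seq bool) := [:: [:: true; true]].

Definition golden_mean : set (full_shift bool) := sft golden_mean_words.

Local Notation l00 := (false, false).
Local Notation l01 := (false, true).
Local Notation l10 := (true, false).
Local Notation l11 := (true, true).

Definition golden_rel_words : seq (seq (bool * bool)) := [::
  [:: l01; l10; l00; l11];
  [:: l10; l01; l00; l11];
  [:: l11; l00; l01; l00];
  [:: l11; l00; l10; l00];
  [:: l00; l00; l00; l01; l00];
  [:: l00; l00; l00; l10; l00];
  [:: l00; l00; l01; l00; l00];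
  [:: l00; l00; l01; l00; l10];
  [:: l00; l00; l01; l00; l11];
  [:: l00; l00; l01; l10; l01];
  [:: l00; l00; l10; l00; l00];
  [:: l00; l00; l10; l00; l01];
  [:: l00; l00; l10; l00; l11];
  [:: l00; l00; l10; l01; l10];
  [:: l00; l01; l00; l10; l00];
  [:: l00; l01; l10; l00; l00];
  [:: l00; l01; l10; l00; l01];
  [:: l00; l01; l10; l01; l10];
  [:: l00; l10; l00; l01; l00];
  [:: l00; l10; l01; l00; l00];
  [:: l00; l10; l01; l00; l10];
  [:: l00; l10; l01; l10; l01];
  [:: l01; l00; l00; l01; l00];
  [:: l01; l00; l01; l00; l00];
  [:: l01; l00; l01; l00; l10];
  [:: l01; l00; l01; l00; l11];
  [:: l01; l00; l01; l10; l01];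
  [:: l01; l10; l00; l00; l00];
  [:: l01; l10; l00; l00; l10];
  [:: l01; l10; l00; l00; l11];
  [:: l01; l10; l00; l10; l01];
  [:: l10; l00; l00; l10; l00];
  [:: l10; l00; l10; l00; l00];
  [:: l10; l00; l10; l00; l01];
  [:: l10; l00; l10; l00; l11];
  [:: l10; l00; l10; l01; l10];
  [:: l10; l01; l00; l00; l00];
  [:: l10; l01; l00; l00; l01];
  [:: l10; l01; l00; l00; l11];
  [:: l10; l01; l00; l01; l10];
  [:: l11; l00; l00; l01; l00];
  [:: l11; l00; l00; l10; l00];
  [:: l11; l00; l01; l10; l01];
  [:: l11; l00; l10; l01; l10];
  [:: l00; l00; l01; l00; l01; l10];
  [:: l00; l00; l10; l00; l10; l01];
  [:: l00; l01; l00; l00; l10; l00];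
  [:: l00; l01; l00; l10; l01; l10];
  [:: l00; l01; l10; l01; l00; l00];
  [:: l00; l01; l10; l01; l00; l10];
  [:: l00; l10; l00; l00; l01; l00];
  [:: l00; l10; l00; l01; l10; l01];
  [:: l00; l10; l01; l10; l00; l00];
  [:: l00; l10; l01; l10; l00; l01];
  [:: l01; l00; l01; l00; l01; l10];
  [:: l01; l00; l10; l00; l10; l00];
  [:: l01; l10; l00; l00; l01; l10];
  [:: l01; l10; l00; l01; l10; l00];
  [:: l01; l10; l01; l10; l00; l10];
  [:: l10; l00; l01; l00; l01; l00];
  [:: l10; l00; l10; l00; l10; l01];
  [:: l10; l01; l00; l00; l10; l01];
  [:: l10; l01; l00; l10; l01; l00];
  [:: l10; l01; l10; l01; l00; l01]].

Definition golden_rel : set (full_shift (bool * bool)%type) :=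
  sft golden_rel_words `&` square golden_mean.

(* The length-two patterns in which one of the components reads 11. *)
Definition component11 : set (seq (bool * bool)) :=
  [set w | [seq a.1 | a <- w] = [:: true; true] \/
           [seq a.2 | a <- w] = [:: true; true]].

(* Main.v *)
Require Import Defs.
From HB Require Import structures.
From mathcomp Require Import all_boot all_order all_algebra.
From mathcomp Require Import all_classical all_reals all_analysis.
From mathcomp Require Import zify ring lra.

Set Implicit Arguments.
Unset Strict Implicit.
Unset Printing Implicit Defensive.

Import Order.TTheory GRing.Theory Num.Theory.
Import numFieldNormedType.Exports.

Local Open Scope classical_set_scope.
Local Open Scope ring_scope.
Local Open Scope quotient_scope.

(** The matrix M multiplies Z[phi] by the golden ratio phi: with psi = - 1 / phi and the
    coordinates u = a phi + b and t = a psi + b, it acts on R^2 by (u, t) |-> (phi u, psi t),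
    and Z^2 becomes the lattice of the pairs (z, z') of an element of Z[phi] and its
    conjugate. A bi-infinite sequence of bits x is sent to the point [golden_code x] of the
    torus with coordinates
      u(x) = sum of x(k) phi^(-k) over k >= 1,   t(x) = - sum of x(-k) psi^k over k >= 0.
    The shift changes (u, t) to (phi u - x(1), psi t - x(1)), so that the code intertwines
    the shift and M ([golden_code_shift]). It is continuous.

    On the golden mean shift X the code is onto ([golden_code_surjective]). Greedy expansions
    show that the compact image contains the image of the half-line t = 0, u >= 0, which is
    dense. Since X is compact and the torus is Hausdorff, the torus is the quotient of X by
    the kernel of the code.

    The kernel is computed by a finite automaton. If x and y have the same code, then
    z(n) = u(shift^n x) - u(shift^n y) is an element of Z[phi] whose conjugate is the
    difference of the t coordinates, and z(n + 1) = phi z(n) - (x(n + 1) - y(n + 1)).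
    The ranges of u and t on X leave seven possible values, the [states], so (x, y)
    labels a bi-infinite path of the automaton ([golden_code_eq_golden_rel]).
    Conversely, such a path is a bounded solution of the recurrence, and bounded
    solutions are unique because phi is expanding; hence the label of a path lies in the
    kernel ([golden_rel_golden_code_eq]). Finally, a pair of points of X labels a
    bi-infinite path if and only if it avoids the listed patterns. No listed pattern,
    once extended by a letter on each side without creating 11 in a component, can be
    read by the automaton ([golden_rel_words_no_path]), and an admissible word of length
    5 determines the state, in a way that is compatible with the transitions
    ([state_of_step]); both are finite verifications.

    For minimality, every admissible word of length at most 5 extends by a letter to the
    right and to the left to an admissible word. As the patterns have length at most 6,
    every admissible word extends to a point of the relation ([golden_rel_realize]), so the
    forbidden words are those which contain a listed pattern or 11 in a component.

    For expansiveness, the difference of two orbits which stay close is a Fibonacci sequence in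
    R/Z that lifts to a bounded bi-infinite Fibonacci sequence of reals, and such a sequence
    is zero. *)

(** * The transition automaton and the finite verifications *)

Local Notation letter := (bool * bool)%type.

Definition letters : seq letter :=
  [:: (false, false); (false, true); (true, false); (true, true)].

Definition no11 (s : seq bool) : bool := ~~ infix [:: true; true] s.

(** Words over pairs of bits in which no forbidden pattern of the relation occurs and
    neither component contains 11. *)
Definition admissible (w : seq letter) : bool :=
  [&& all (fun v => ~~ infix v w) golden_rel_words,
      no11 (unzip1 w) & no11 (unzip2 w)].

(** All words of length [n]. *)
Fixpoint words (n : nat) : seq (seq letter) :=
  if n is k.+1 then [seq a :: w | a <- letters, w <- words k] else [:: [::]].

Lemma mem_letters (l : letter) : l \in letters.
Proof. by case: l => [[] []]. Qed.

Lemma mem_words w : w \in words (size w).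
Proof.
elim: w => [//|a w IH]; apply: allpairs_f IH.
exact: mem_letters.
Qed.

(** A state [(m, n)] stands for the element m + n phi of Z[phi]. Reading the pair of
    bits (a, b) sends z to phi z - (a - b), where phi (m + n phi) = n + (m + n) phi. *)
Definition state := (int * int)%type.
Definition step (z : state) (l : letter) : state :=
  (z.2 - (l.1%:R - l.2%:R), z.1 + z.2).

(** The seven elements z of Z[phi] with |z| <= 1 whose conjugate has absolute value
    at most phi + 1, see [mem_states_of_bounds]. *)
Definition states : seq state :=
  [:: (-2%:Z, 1); (-1, 0); (-1, 1); (0, 0); (1, -1); (1, 0); (2%:Z, -1)].

(** The automaton can read [w] from [z] without leaving [states]. *)
Fixpoint has_path (z : state) (w : seq letter) : bool :=
  (z \in states) && (if w is l :: w' then has_path (step z l) w' else true).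

(** The first state from which [w] can be read. An admissible word of length 5 can be
    read from exactly one state, so that no choice is made for such words. *)
Definition state_of (w : seq letter) : state :=
  nth (0, 0) states (find (has_path^~ w) states).

Lemma short_words_extend_right : all (fun n => all (fun w => admissible w ==>
  has (fun l => admissible (rcons w l)) letters) (words n)) (iota 0 6).
Proof. by vm_compute. Qed.

Lemma short_words_extend_left : all (fun n => all (fun w => admissible w ==>
  has (fun l => admissible (l :: w)) letters) (words n)) (iota 0 6).
Proof. by vm_compute. Qed.

(** On admissible words of length 6, the states read off the two windows of length 5
    are related by the transition on the first letter. *)
Lemma state_of_step : all (fun w => admissible w ==>
  [&& state_of (take 5 w) \in states &
      state_of (behead w) ==
      step (state_of (take 5 w)) (head (false, false) w)]) (words 6).
Proof. by vm_compute. Qed.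

(** Some of the patterns of length 4 label a path of the automaton; a letter is added
    on each side to exclude them. *)
Lemma golden_rel_words_no_path : all (fun v => all (fun l => all (fun r =>
    let w := l :: rcons v r in
    no11 (unzip1 w) && no11 (unzip2 w) ==> ~~ has (has_path^~ w) states)
  letters) letters) golden_rel_words.
Proof. by vm_compute. Qed.

(** Every proper subword of a forbidden pattern is admissible: it suffices to delete
    the first or the last letter. *)
Lemma golden_rel_words_ends : all (fun w =>
  admissible (behead w) && admissible (take (size w).-1 w)) golden_rel_words.
Proof. by vm_compute. Qed.

(** * Admissible words are the words of the relation *)

Section Infixes.
Variable T : eqType.
Implicit Types u w : seq T.

Lemma infix_proper u w : infix u w -> u != w ->
  infix u (behead w) || infix u (take (size w).-1 w).
Proof.
case: (lastP w) => [|{}w b]; first by rewrite infixs0 => ->.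
rewrite infix_rconsl size_rcons /= -cats1 take_size_cat // => /orP[|->]; last first.
  by rewrite orbT.
move=> /suffixP[[|a p] E]; first by rewrite E eqxx.
by move=> _; apply/orP; left; rewrite E /=; apply: suffix_infix.
Qed.

Lemma infix_last_window n u w l : (size u <= n.+1)%N -> infix u (rcons w l) ->
  infix u w || infix u (rcons (drop (size w - n) w) l).
Proof.
move=> un; rewrite infix_rconsl => /orP[|->//]; rewrite suffixE => /eqP <-.
apply/orP; right; rewrite size_rcons -drop_rcons; last by rewrite leq_subLR leq_addl.
have -> : ((size w).+1 - size u = ((size w).+1 - size u - (size w - n)) + (size w - n))%N.
  by lia.
by rewrite -drop_drop infix_drop.
Qed.

Lemma infix_first_window n u w l : (size u <= n.+1)%N -> infix u (l :: w) ->
  infix u w || infix u (l :: take n w).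
Proof.
move=> un; rewrite infix_consl => /orP[|->//]; rewrite prefixE => /eqP <-.
apply/orP; right; rewrite -[l :: take n w]/(take n.+1 (l :: w)).
by rewrite -(take_takel (l :: w) un) infix_take.
Qed.

End Infixes.

Lemma admissible_infix u w : infix u w -> admissible w -> admissible u.
Proof.
have infix_map (T : eqType) (f : letter -> T) : infix u w -> infix (map f u) (map f w).
  by move=> /infixP[p [s ->]]; rewrite !map_cat infix_infix.
move=> uw /and3P[/allP H1 H2 H3]; apply/and3P; split.
- by apply/allP => v /H1; apply: contra => vu; exact: infix_trans vu uw.
- by apply: contra H2 => vu; apply: infix_trans vu _; exact: infix_map.
- by apply: contra H3 => vu; apply: infix_trans vu _; exact: infix_map.
Qed.

(** The forbidden patterns have length at most 6, so admissibility of [w] follows from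
    that of two words which together contain the infixes of length at most 6 of [w]. *)
Lemma admissible_cover w v v' :
  (forall (T : eqType) (f : letter -> T) u, (size u <= 6)%N ->
    infix u (map f w) -> infix u (map f v) || infix u (map f v')) ->
  admissible v -> admissible v' -> admissible w.
Proof.
have size_golden u : u \in golden_rel_words -> (size u <= 6)%N.
  by apply/allP : u; vm_compute.
move=> cov /and3P[/allP H1 H2 H3] /and3P[/allP H1' H2' H3']; apply/and3P; split.
- apply/allP => u uG; apply/negP; move: (cov _ id u (size_golden _ uG)).
  by rewrite !map_id (negPf (H1 _ uG)) (negPf (H1' _ uG)) => h /h.
- by apply/negP => /(cov _ fst); rewrite (negPf H2) (negPf H2') => /(_ isT).
- by apply/negP => /(cov _ snd); rewrite (negPf H3) (negPf H3') => /(_ isT).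
Qed.

Lemma extend_right w : admissible w ->
  has (fun l => admissible (rcons w l)) letters.
Proof.
move=> adw; pose v := drop (size w - 5) w.
have adv : admissible v by apply: admissible_infix adw; exact: infix_drop.
have sv : (size v < 6)%N by rewrite size_drop; lia.
have /allP/(_ (size v)) := short_words_extend_right; rewrite mem_iota => /(_ sv)/allP.
move=> /(_ v (mem_words v))/implyP/(_ adv); apply: sub_has => l.
apply: admissible_cover adw => T f u u6; rewrite !map_rcons map_drop.
by rewrite -(size_map f w); exact: infix_last_window.
Qed.

Lemma extend_left w : admissible w ->
  has (fun l => admissible (l :: w)) letters.
Proof.
move=> adw; pose v := take 5 w.
have adv : admissible v by apply: admissible_infix adw; exact: infix_take.
have sv : (size v < 6)%N by rewrite size_take_min; lia.
have /allP/(_ (size v)) := short_words_extend_left; rewrite mem_iota => /(_ sv)/allP.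
move=> /(_ v (mem_words v))/implyP/(_ adv); apply: sub_has => l.
apply: admissible_cover adw => T f u u6; rewrite !map_cons map_take.
exact: infix_first_window.
Qed.

(** The word of length [n] of a configuration which starts at position [i]. *)
Definition window (S : finType) (z : full_shift S) (i : int) (n : nat) : seq S :=
  mkseq (fun j : nat => z (i + j%:Z)) n.

Lemma infix_window (S : finType) (z : full_shift S) i n w :
  infix w (window z i n) -> exists k, w = window z (i + k%:Z) (size w).
Proof.
rewrite infixE; move: (infix_index _ _) => k /eqP Ew; exists k.
have sw : (size w <= n - k)%N.
  by rewrite -{1}Ew size_take_min size_drop size_mkseq; exact: geq_minr.
apply: (@eq_from_nth _ (z 0)); rewrite ?size_mkseq // => j jw.
rewrite -{1}Ew nth_take // nth_drop !nth_mkseq //; last first.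
  by rewrite -ltn_subRL (leq_trans jw sw).
by rewrite -addrA PoszD.
Qed.

Lemma occurs_infix (S : finType) (z : full_shift S) u w :
  infix u w -> occurs w z -> occurs u z.
Proof.
move=> uw [i Ew]; move: uw; rewrite Ew -/(window z i (size w)) => /infix_window[k Eu].
by exists (i + k%:Z).
Qed.

Lemma unzip1_window (x y : full_shift bool) i n :
  unzip1 (window (pairing x y) i n) = window x i n.
Proof. by rewrite /window /mkseq /unzip1 -map_comp. Qed.

Lemma unzip2_window (x y : full_shift bool) i n :
  unzip2 (window (pairing x y) i n) = window y i n.
Proof. by rewrite /window /mkseq /unzip2 -map_comp. Qed.

Lemma golden_meanP (x : full_shift bool) :
  golden_mean x <-> forall i, ~ (x i /\ x (i + 1)).
Proof.
split=> [gx i [xi xi1]|gx w].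
  by apply: (gx _ (mem_head _ _)); exists i; rewrite /= /mkseq /= addr0 xi xi1.
rewrite inE => /eqP -> [i /= [/esym E0 /esym E1]]; apply: (gx i).
by split; [rewrite -[i]addr0 E0|rewrite E1].
Qed.

Lemma golden_relP z : golden_rel z <-> forall i n, admissible (window z i n).
Proof.
split=> [[Gz [x [y [gx gy Ez]]]] i n|adz].
  apply/and3P; split.
  - apply/allP => v vG; apply/negP => /infix_window[k Ev].
    by apply: (Gz v vG); exists (i + k%:Z).
  - apply/negP; rewrite Ez unzip1_window => /infix_window[k Ev].
    by apply: (gx _ (mem_head _ _)); exists (i + k%:Z).
  - apply/negP; rewrite Ez unzip2_window => /infix_window[k Ev].
    by apply: (gy _ (mem_head _ _)); exists (i + k%:Z).
split.
  move=> v vG [i Ev]; have /and3P[/allP/(_ v vG)] := adz i (size v).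
  by rewrite -[window _ _ _]Ev infix_refl.
exists (fun i => (z i).1), (fun i => (z i).2); split; last first.
- by apply/funext => i; rewrite /pairing; case: (z i).
- move=> w /[!inE] /eqP -> [i /= Ev]; have /and3P[_ _] := adz i 2%N.
  have -> : unzip2 (window z i 2) = [:: true; true] by rewrite Ev.
  by rewrite /no11 infix_refl.
- move=> w /[!inE] /eqP -> [i /= Ev]; have /and3P[_ + _] := adz i 2%N.
  have -> : unzip1 (window z i 2) = [:: true; true] by rewrite Ev.
  by rewrite /no11 infix_refl.
Qed.

Local Notation l00 := (false, false).

(** Adds to an admissible word one letter on each side, keeping it admissible. *)
Definition grow (w : seq letter) : seq letter :=
  let l := nth l00 letters (find (fun l => admissible (l :: w)) letters) in
  let r := nth l00 letters (find (fun r => admissible (rcons (l :: w) r)) letters) in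
  rcons (l :: w) r.

Lemma admissible_grow w : admissible w -> admissible (grow w).
Proof.
move=> adw; apply: (nth_find l00 (a := fun r => admissible (rcons _ r))).
apply: extend_right; apply: (nth_find l00 (a := fun l => admissible (l :: _))).
exact: extend_left.
Qed.

Lemma size_iter_grow n w : size (iter n grow w) = (size w + n.*2)%N.
Proof.
by elim: n => [|n IH]; rewrite ?addn0 //= size_rcons IH doubleS !addnS.
Qed.

Lemma nth_iter_grow k w j : (j < size w)%N ->
  nth l00 (iter k grow w) (k + j) = nth l00 w j.
Proof.
move=> jw; elim: k => [//|k IH]; rewrite iterS /= nth_rcons size_iter_grow.
by rewrite ifT ?IH //; lia.
Qed.

(** The admissible word is grown indefinitely on both sides, the position of its letters
    being fixed. *)
Lemma golden_rel_realize w : admissible w -> exists2 z, golden_rel z & occurs w z.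
Proof.
move=> adw; pose w1 := grow w.
have s1 : size w1 = (size w).+2 by rewrite /= size_rcons.
(* After N steps of growth the letter at position 0 has index N. *)
pose z : full_shift letter := fun i =>
  nth l00 (iter (absz i) grow w1) (absz (i + (absz i)%:Z)).
have zE i N : (absz i <= N)%N -> z i = nth l00 (iter N grow w1) (absz (i + N%:Z)).
  move=> iN; rewrite /z -(subnK iN) iterD.
  rewrite -(@nth_iter_grow (N - absz i)%N); last by rewrite size_iter_grow s1; lia.
  by congr nth; lia.
have winE i n : infix (window z i n) (iter (absz i + n)%N grow w1).
  have -> : window z i n = take n
      (drop (absz (i + (absz i + n)%N%:Z)) (iter (absz i + n)%N grow w1)).
    apply: (@eq_from_nth _ l00).
      rewrite size_mkseq size_take_min size_drop size_iter_grow s1; lia.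
    rewrite size_mkseq => j jn; rewrite nth_mkseq // nth_take // nth_drop.
    by rewrite (zE _ (absz i + n)%N); [congr nth; lia|lia].
  by apply: infix_trans (infix_take _ _) _; exact: infix_drop.
exists z; last first.
  apply: (@occurs_infix _ _ _ w1).
    by rewrite /w1 /= -cats1; exact: (infix_infix [:: _] w [:: _]).
  exists 0; apply: (@eq_from_nth _ l00); rewrite ?size_mkseq // => j jw.
  rewrite nth_mkseq // add0r (zE _ j) //.
  by rewrite -(nth_iter_grow j jw); congr nth; lia.
apply/golden_relP => i n; apply: admissible_infix (winE i n) _.
elim: (absz i + n)%N => [|k IH]; first exact: admissible_grow.
exact: admissible_grow.
Qed.

Lemma golden_rel_minimal :
  minimal_forbidden golden_rel = [set` golden_rel_words] `|` component11.
Proof.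
apply/seteqP; split=> w.
  case=> wF wmin.
  have sub u : infix u w -> forbidden golden_rel u -> u = w.
    by move=> uw uF; apply/eqP; apply: contrapT => /negP uw'; exact: wmin uw uw' uF.
  have notadw : ~~ admissible w.
    by apply/negP => /golden_rel_realize[z Gz /(wF z Gz)].
  have unz (T : eqType) (f : letter -> T) u : infix u (map f w) ->
      exists2 v, infix v w & map f v = u.
    rewrite infixE => /eqP <-; rewrite -map_drop -map_take.
    exists (take (size u) (drop (infix_index u (map f w)) w)) => //.
    exact: infix_trans (infix_take _ _) (infix_drop _ _).
  move: notadw; rewrite 2!negb_and => /or3P[/allPn[v vG /negPn vw]||].
  - by left; rewrite /= -(sub v vw) // => z [Gz _] /(Gz _ vG).
  - move=> /negPn/unz[v vw Ev]; right; left; rewrite -(sub v vw) //.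
    move=> z [_ [x [y [gx gy ->]]]] [i Evz].
    apply: (gx _ (mem_head _ _)); exists i; rewrite -Ev size_map.
    by rewrite {1}Evz -/(window _ _ _) -/(unzip1 _) unzip1_window.
  - move=> /negPn/unz[v vw Ev]; right; right; rewrite -(sub v vw) //.
    move=> z [_ [x [y [gx gy ->]]]] [i Evz].
    apply: (gy _ (mem_head _ _)); exists i; rewrite -Ev size_map.
    by rewrite {1}Evz -/(window _ _ _) -/(unzip2 _) unzip2_window.
move=> Hw; have ends : admissible (behead w) && admissible (take (size w).-1 w).
  case: Hw => [wG|]; first exact: (allP golden_rel_words_ends).
  by case: w => [|[[] []] [|[[] []] [|? ?]]] //= [].
split.
  move=> z Gz [i Ewz]; case: Hw => [wG|Hw].
    by case: Gz => /(_ w wG) + _; apply; exists i.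
  case: Gz => _ [x [y [gx gy Ez]]]; move: Ewz; rewrite Ez -/(window _ _ _) => Ewz.
  case: Hw => Ew.
    apply: (gx _ (mem_head _ _)); exists i.
    by rewrite -{1}Ew Ewz -/(unzip1 _) unzip1_window -{1}(size_map fst w) Ew.
  apply: (gy _ (mem_head _ _)); exists i.
  by rewrite -{1}Ew Ewz -/(unzip2 _) unzip2_window -{1}(size_map snd w) Ew.
move=> u uw uw' uF; case/andP: ends => e1 e2.
have /golden_rel_realize[z Gz] : admissible u.
  by case/orP: (infix_proper uw uw') => /admissible_infix; apply.
exact: uF z Gz.
Qed.

Lemma golden_mean_minimal : minimal_forbidden golden_mean = [set [:: true; true]].
Proof.
have realize w : no11 w -> exists2 x, golden_mean x & occurs w x.
  move=> now.
  pose x : full_shift bool := fun i => if i is Posz k then nth false w k else false.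
  exists x; last first.
    exists 0; apply: (@eq_from_nth _ false); rewrite ?size_mkseq // => j jw.
    by rewrite nth_mkseq // add0r.
  apply/golden_meanP => -[k|[|k]] [] //=; rewrite addn1 => wk wk1.
  have kw : (k.+1 < size w)%N.
    by rewrite ltnNge; apply/negP => h; rewrite nth_default in wk1.
  move/negP: now; apply; apply: infix_trans (infix_drop w k).
  rewrite (drop_nth false (ltnW kw)) (drop_nth false kw) wk wk1.
  exact: (prefix_infix [:: true; true]).
have F11 : forbidden golden_mean [:: true; true].
  by move=> x gx; apply: gx; exact: mem_head.
apply/seteqP; split=> w.
  case=> wF wmin; apply/esym/eqP; apply: contrapT => /negP w11.
  apply: (wmin _ _ w11 F11); apply: contrapT => /negP now.
  by case: (realize w now) => x gx; exact: wF x gx.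
move=> ->; split=> // u uw uw'; have [x gx ox] : exists2 x, golden_mean x & occurs u x.
  apply: realize; apply/negP => vu.
  have su := size_infix uw; have sv := size_infix vu.
  move: vu uw'; case: u uw su sv => [|a [|b [|? ?]]] //= _ _ _.
  by case: a; case: b.
by move=> uF; exact: uF x gx ox.
Qed.

(** * The relation is read along the paths of the automaton *)

(** A point of the relation is read along a bi-infinite path of the automaton. *)
Lemma state_seq (z : full_shift letter) : golden_rel z ->
  exists st : int -> state, forall i,
    st i \in states /\ st (i + 1) = step (st i) (z (i + 1)).
Proof.
move=> /golden_relP Gz; exists (fun i => state_of (window z (i + 1) 5)) => i.
have /allP/(_ _ (mem_words (window z (i + 1) 6))) := state_of_step.
rewrite (Gz _ 6%N) implyTb => /andP[+ /eqP Est].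
have -> : take 5 (window z (i + 1) 6) = window z (i + 1) 5 by [].
split=> //; have -> : window z (i + 1 + 1) 5 = behead (window z (i + 1) 6).
  by apply: (@eq_from_nth _ (z 0)) => // j; rewrite size_mkseq => j5;
     rewrite nth_behead !nth_mkseq //; congr z; lia.
by rewrite Est; congr step; exact: (congr1 z (addr0 _)).
Qed.

(** Conversely, the label of a bi-infinite path of the automaton is in the relation. *)
Lemma golden_rel_path (x y : full_shift bool) (st : int -> state) :
  golden_mean x -> golden_mean y ->
  (forall i, st i \in states /\ st (i + 1) = step (st i) (pairing x y (i + 1))) ->
  golden_rel (pairing x y).
Proof.
move=> gx gy Hst; split; last by exists x, y.
set z := pairing x y => v vG [i Ev].
have no11_window (t : full_shift bool) j n : golden_mean t -> no11 (window t j n).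
  move=> gt; apply/negP => /infix_window[k Ek].
  by apply: (gt _ (mem_head _ _)); exists (j + k%:Z).
have path n j : has_path (st j) (window z (j + 1) n).
  elim: n j => [|n IH] j; first by rewrite /= (Hst j).1.
  have -> : window z (j + 1) n.+1 = z (j + 1) :: window z (j + 1 + 1) n.
    apply: (@eq_from_nth _ (z 0)); first by rewrite [RHS]/= !size_mkseq.
    rewrite size_mkseq => -[|k] kn; rewrite nth_mkseq //= ?addr0 //.
    by rewrite nth_mkseq //; congr z; lia.
  by rewrite /= (Hst j).1 -(Hst j).2 IH.
have /allP/(_ v vG)/allP/(_ (z (i - 1)) (mem_letters _)) := golden_rel_words_no_path.
move=> /allP/(_ (z (i + (size v)%:Z)) (mem_letters _)); cbv beta zeta.
have -> : z (i - 1) :: rcons v (z (i + (size v)%:Z)) = window z (i - 1 - 1 + 1) (size v).+2.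
  rewrite Ev size_mkseq.
  apply: (@eq_from_nth _ (z 0)); first by rewrite [LHS]/= size_rcons !size_mkseq.
  rewrite [size _]/= size_rcons size_mkseq => -[|k] kn.
    by rewrite nth_mkseq //=; congr z; lia.
  rewrite [nth _ (_ :: _) _]/= nth_rcons size_mkseq [RHS]nth_mkseq //.
  case: ltnP => kv; first by rewrite nth_mkseq //; congr z; lia.
  by rewrite ifT; [congr z; lia|apply/eqP; lia].
rewrite unzip1_window unzip2_window !no11_window // implyTb => /negP; apply.
by apply/hasP; exists (st (i - 1 - 1)); [exact: (Hst _).1|exact: path].
Qed.

(** * Bounded sequences that expand vanish *)

Section Growth.
Variable R : realType.

Lemma growth_le0 (c M : R) (x : nat -> R) : 1 < c ->
  (forall k, c * x k <= x k.+1) -> (forall k, x k <= M) -> x 0%N <= 0.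
Proof.
move=> c1 xS xM; rewrite leNgt; apply/negP => x0.
have c0 : 0 < c - 1 by rewrite subr_gt0.
have xk k : x 0%N * (1 + k%:R * (c - 1)) <= x k.
  elim: k => [|k IH]; first by rewrite mul0r addr0 mulr1.
  apply: le_trans (xS k); rewrite -natr1.
  have : c * (x 0%N * (1 + k%:R * (c - 1))) <= c * x k.
    by rewrite ler_pM2l // (lt_trans _ c1).
  apply: le_trans; rewrite -subr_ge0.
  have -> : c * (x 0%N * (1 + k%:R * (c - 1))) - x 0%N * (1 + (k%:R + 1) * (c - 1))
    = x 0%N * (k%:R * ((c - 1) * (c - 1))) by ring.
  by rewrite !mulr_ge0 // ltW.
have M0 : 0 <= M by exact: le_trans (ltW x0) (xM _).
have xc : 0 < x 0%N * (c - 1) by rewrite mulr_gt0.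
have := archi_boundP (divr_ge0 M0 (ltW xc)); set k := Num.bound _.
rewrite ltr_pdivrMr // => Mk; have := le_trans (xk k) (xM k); apply/negP.
rewrite -ltNge (lt_le_trans Mk) // -subr_ge0.
have -> : x 0%N * (1 + k%:R * (c - 1)) - k%:R * (x 0%N * (c - 1)) = x 0%N by ring.
exact: ltW.
Qed.

Lemma bounded_growth_eq0 (c M : R) (x : nat -> R) : 1 < c ->
  (forall k, c * `|x k| <= `|x k.+1|) -> (forall k, `|x k| <= M) -> x 0%N = 0.
Proof.
move=> c1 xS xM; apply/eqP; rewrite -normr_le0.
exact: (@growth_le0 c M (fun k => `|x k|)).
Qed.

(** A bounded bi-infinite solution of the Fibonacci recurrence vanishes, because
    3 a(n) = a(n + 2) + a(n - 2). *)
Lemma bounded_fib_eq0 (M : R) (a : int -> R) :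
  (forall n, a (n + 1) = a n + a (n - 1)) -> (forall n, `|a n| <= M) ->
  forall n, a n = 0.
Proof.
move=> aS aM n.
have a3 m : 3 * a m = a (m + 2) + a (m - 2).
  have := aS m; have := aS (m - 1); have := aS (m + 1).
  rewrite !subrK addrK -!addrA -!opprD => -> E1 E2.
  by rewrite E2; move: E1; rewrite -[1 + 1 :> int]/2; lra.
(* Each use of the identity gains a factor 2 / 3 on the common bound. *)
have bound k m : (3/2) ^+ k * `|a m| <= M.
  elim: k m => [|k IH] m; first by rewrite mul1r.
  have -> : `|a m| = `|a (m + 2) + a (m - 2)| / 3.
    by rewrite -a3 normrM ger0_norm // mulrAC divff ?mul1r.
  have := IH (m + 2); have := IH (m - 2).
  have : (3 / 2) ^+ k * `|a (m + 2) + a (m - 2)| <=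
         (3 / 2) ^+ k * (`|a (m + 2)| + `|a (m - 2)|).
    by rewrite ler_wpM2l ?exprn_ge0 ?ler_normD //; lra.
  rewrite exprS mulrDr.
  have -> : 3 / 2 * (3 / 2) ^+ k * (`|a (m + 2) + a (m - 2)| / 3) =
    ((3 / 2) ^+ k * `|a (m + 2) + a (m - 2)|) / 2 by field.
  by lra.
have /(_ _ _ _)/eqP : _ -> _ -> _ -> (3 / 2) ^+ 0 * a n = 0 :=
  @bounded_growth_eq0 (3 / 2) M (fun k => (3 / 2) ^+ k * a n).
rewrite expr0 mul1r => h; apply/eqP/h; first by lra.
  by move=> k; rewrite !normrM exprS normrM (ger0_norm (_ : 0 <= 3/2)) ?mulrA //; lra.
by move=> k; rewrite normrM ger0_norm ?exprn_ge0 //; lra.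
Qed.

End Growth.

(** * The torus automorphism *)

Lemma compact_hausdorff_inverse (T U : topologicalType) (f : T -> U) (g : U -> T) :
  compact [set: T] -> hausdorff_space U -> cancel f g -> cancel g f ->
  continuous f -> continuous g.
Proof.
move=> cT hU fK gK cf; apply/continuous_closedP => A cA.
have -> : g @^-1` A = f @` A.
  apply/seteqP; split=> [u gu|_ [t At <-]]; first by exists (g u).
  by rewrite /= fK.
apply: (compact_closed hU); apply: continuous_compact.
  exact: continuous_subspaceT.
exact: subclosed_compact cA cT _.
Qed.

Section TorusTopology.
Variable R : realType.

Lemma circle_piB (x y : R) :
  \pi_(circle R) (x - y) = \pi_(circle R) x - \pi_(circle R) y.
Proof. exact: (raddfB (\pi_(Quotient.quot (int_subgroup R)))). Qed.

Lemma circle_pi0 : \pi_(circle R) (0 : R) = 0.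
Proof. exact: (raddf0 (\pi_(Quotient.quot (int_subgroup R)))). Qed.

Lemma circle_pi_int (n : int) : \pi_(circle R) (n%:~R : R) = 0.
Proof. by rewrite -circle_pi0; apply/circle_piP; exists n; rewrite subr0. Qed.

Lemma circle_pi_continuous : continuous (\pi_(circle R) : R -> circle R).
Proof. exact: pi_continuous. Qed.

Lemma circle_pi_itv : \pi_(circle R) @` `[0 : R, 1] = [set: circle R].
Proof.
apply/seteqP; split=> // a _; exists (repr a - (Num.floor (repr a))%:~R).
  rewrite /= in_itv /= subr_ge0 floor_le /= lerBlDl ltW //.
  by have := floorD1_gt (repr a); rewrite intrD1.
by rewrite circle_piB circle_pi_int subr0 reprK.
Qed.

Lemma circle_compact : compact [set: circle R].
Proof.
rewrite -circle_pi_itv; apply: continuous_compact; last exact: segment_compact.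
exact/continuous_subspaceT/circle_pi_continuous.
Qed.

Lemma torus_compact : compact [set: torus R].
Proof.
have -> : [set: torus R] = [set: circle R] `*` [set: circle R].
  by apply/seteqP; split.
exact: compact_setX circle_compact circle_compact.
Qed.

Lemma torus_hausdorff : hausdorff_space (torus R).
Proof. exact: metric_hausdorff. Qed.

Lemma circle_add_continuous : continuous (fun p : torus R => p.1 + p.2).
Proof.
move=> p; apply/cvg_ballP => e e0.
have e2 : 0 < e / 2 by rewrite divr_gt0.
exists (ball p.1 (e / 2), ball p.2 (e / 2)).
  by split; exact: nbhsx_ballx.
move=> q [].
move=> /circle_distP[x [x' [<- <- xx']]] /circle_distP[y [y' [<- <- yy']]].
apply/circle_distP; exists (x + y), (x' + y'); rewrite !circle_piD; split=> //.
have -> : x + y - (x' + y') = (x - x') + (y - y') by ring.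
by rewrite (le_lt_trans (ler_normD _ _)) // [e]splitr ltrD.
Qed.

Lemma torus_map_fib (p : torus R) : torus_map fib_mx p = (p.1 + p.2, p.1).
Proof. by rewrite /torus_map !mxE /= !mulr1z mulr0z addr0. Qed.

Lemma torus_map_fib_continuous : continuous (torus_map fib_mx : torus R -> torus R).
Proof.
have -> : torus_map fib_mx = fun p : torus R => (p.1 + p.2, p.1) :> torus R.
  by apply/funext => p; exact: torus_map_fib.
move=> p; exact: (@cvg_pair _ _ _ (nbhs p) _ _ _ _ _ _ _
  (@circle_add_continuous p) (@cvg_fst _ _ _ _ _)).
Qed.

(** The inverse of the automorphism, (a, b) |-> (b, a - b). *)
Definition torus_fib_inv (p : torus R) : torus R := (p.2, p.1 - p.2).

Lemma torus_map_fibK : cancel (torus_map fib_mx) torus_fib_inv.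
Proof. by case=> a b; rewrite torus_map_fib /torus_fib_inv /= addrAC subrr add0r. Qed.

Lemma torus_fib_invK : cancel torus_fib_inv (torus_map fib_mx).
Proof. by case=> a b; rewrite torus_map_fib /torus_fib_inv /= addrCA subrr addr0. Qed.

Lemma torus_fib_inv_continuous : continuous torus_fib_inv.
Proof.
exact: compact_hausdorff_inverse torus_compact torus_hausdorff
  torus_map_fibK torus_fib_invK torus_map_fib_continuous.
Qed.

Lemma iterzS (T : Type) (f g : T -> T) : cancel g f ->
  forall n x, iterz f g (n + 1) x = f (iterz f g n x).
Proof.
move=> gK [k|[|k]] x; first by have -> : Posz k + 1 = Posz k.+1 by lia.
  by rewrite /= gK.
have -> : Negz k.+1 + 1 = Negz k by rewrite !NegzE; lia.
by rewrite /= gK.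
Qed.

(** A bi-infinite Fibonacci sequence of R/Z with lifts smaller than 1 / 3 lifts to a
    Fibonacci sequence of reals, since the defects are integers of modulus < 1; the
    latter is bounded, hence zero. *)
Lemma circle_bounded_fib_eq0 (D : int -> circle R) (a : int -> R) (M : R) :
  3 * M < 1 -> (forall n, D (n + 1) = D n + D (n - 1)) ->
  (forall n, \pi_(circle R) (a n) = D n) -> (forall n, `|a n| <= M) ->
  forall n, D n = 0.
Proof.
move=> M1 DS aD aM n; rewrite -aD.
have -> : a n = 0; last exact: circle_pi0.
apply: (@bounded_fib_eq0 _ M) => // {}n.
have /circle_piP[m Em] : \pi_(circle R) (a (n + 1)) = \pi_(circle R) (a n + a (n - 1)).
  by rewrite circle_piD !aD DS.
have : `|m%:~R| < 1 :> R.
  have := aM (n + 1); have := aM n; have := aM (n - 1).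
  rewrite -Em !ler_norml ltr_norml => /andP[? ?] /andP[? ?] /andP[? ?].
  by apply/andP; split; lra.
rewrite -intr_norm ltrz1 => m0; have m0' : m = 0 by lia.
by apply/eqP; rewrite -subr_eq0 Em m0'.
Qed.

Lemma torus_map_fib_expansive : expansive (torus_map fib_mx : torus R -> torus R).
Proof.
split; first exact: torus_compact.
exists torus_fib_inv; split.
- exact: torus_map_fibK.
- exact: torus_fib_invK.
- exact: torus_map_fib_continuous.
- exact: torus_fib_inv_continuous.
exists (1 / 8); first by lra.
move=> x y xy; apply: contrapT => near_orbits; apply: xy.
pose xs n := iterz (torus_map fib_mx) torus_fib_inv n x.
pose ys n := iterz (torus_map fib_mx) torus_fib_inv n y.
pose D n := (xs n).1 - (ys n).1.
have iterS t n : iterz (torus_map fib_mx) torus_fib_inv (n + 1) t =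
    torus_map fib_mx (iterz (torus_map fib_mx) torus_fib_inv n t).
  exact: iterzS torus_fib_invK _ _.
have D2 n : D (n - 1) = (xs n).2 - (ys n).2.
  by rewrite /D /xs /ys -{3 4}(subrK 1 n) !iterS !torus_map_fib.
have DS n : D (n + 1) = D n + D (n - 1).
  by rewrite D2 /D /xs /ys !iterS !torus_map_fib /= opprD addrACA.
(* Any bound between 1 / 8 and 1 / 3 would do. *)
have /choice[a aP] n : exists r : R, \pi_(circle R) r = D n /\ `|r| <= 1 / 7.
  have : circle_dist (xs n).1 (ys n).1 < 1 / 7.
    have : ~~ (1 / 8 < mdist (xs n) (ys n)).
      by apply/negP => h; apply: near_orbits; exists n.
    rewrite -leNgt ge_max => /andP[le8 _]; apply: le_lt_trans le8 _; lra.
  move=> /circle_distP[r [s [Er Es rs]]]; exists (r - s).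
  by rewrite circle_piB Er Es; split=> //; exact: ltW.
have D0 n : D n = 0.
  apply: (@circle_bounded_fib_eq0 D a (1 / 7)) => //; first by lra.
    by move=> k; exact: (aP k).1.
  by move=> k; exact: (aP k).2.
have E1 : x.1 = y.1 by exact: subr0_eq (D0 0).
have E2 : x.2 = y.2.
  by apply: subr0_eq; rewrite -[LHS]/((xs 0).2 - (ys 0).2) -D2 D0.
by case: x y E1 E2 {near_orbits xs ys D D2 DS a aP D0} => ? ? [? ?] /= -> ->.
Qed.

End TorusTopology.

(** * Expansions in a base of modulus less than 1 *)

Section DigitSum.
Variable R : realType.
Implicit Types (q : R) (b : nat -> bool).

(** The sum of b(k) q^k over k >= 0. *)
Definition digit_sum q b : R := limn (series (fun k => (b k)%:R * q ^+ k)).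

Lemma is_cvg_digit_series q b : `|q| < 1 ->
  cvgn (series (fun k => (b k)%:R * q ^+ k)).
Proof.
move=> q1; apply: normed_cvg.
apply: (@series_le_cvg _ _ (geometric 1 `|q|)).
- by move=> k; exact: normr_ge0.
- by move=> k; rewrite /= mul1r exprn_ge0.
- by move=> k; rewrite /= normrM normrX ler_wpM2r ?exprn_ge0 // normr_nat lern1 leq_b1.
by apply: is_cvg_geometric_series; rewrite normr_id.
Qed.

Lemma digit_sumS q b : `|q| < 1 ->
  digit_sum q b = (b 0%N)%:R + q * digit_sum q (fun k => b k.+1).
Proof.
move=> q1; apply: cvg_lim => //; rewrite -cvg_shiftS.
have -> : [sequence series (fun k => (b k)%:R * q ^+ k) n.+1]_n =
    (fun n => (b 0%N)%:R + q * series (fun k => (b k.+1)%:R * q ^+ k) n).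
  apply/funext => n; rewrite /series /= big_nat_recl // expr0 mulr1; congr (_ + _).
  by rewrite mulr_sumr; apply: eq_bigr => k _; rewrite exprS mulrCA.
apply: cvgD; first exact: cvg_cst.
by apply: cvgMr; exact: is_cvg_digit_series.
Qed.

Lemma digit_sum_bound q b : `|q| < 1 -> `|digit_sum q b| <= (1 - `|q|)^-1.
Proof.
move=> q1; have q0 : 0 < 1 - `|q| by rewrite subr_gt0.
have le_part n : `|series (fun k => (b k)%:R * q ^+ k) n| <= (1 - `|q|)^-1.
  elim: n b => [|n IH] b; first by rewrite /series /= big_geq // normr0 invr_ge0 ltW.
  rewrite /series /= big_nat_recl // expr0 mulr1.
  have -> : \sum_(0 <= i < n) (b i.+1)%:R * q ^+ i.+1 =
      q * series (fun k => (b k.+1)%:R * q ^+ k) n.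
    by rewrite mulr_sumr; apply: eq_bigr => k _; rewrite exprS mulrCA.
  apply: le_trans (ler_normD _ _) _; rewrite normrM.
  have -> : (1 - `|q|)^-1 = 1 + `|q| * (1 - `|q|)^-1 by field; rewrite gt_eqF.
  by rewrite lerD ?ler_wpM2l ?IH // normr_nat lern1 leq_b1.
apply: (@closed_cvg _ _ _ eventually_filter (series (fun k => (b k)%:R * q ^+ k))
  [set x : R | `|x| <= (1 - `|q|)^-1]).
- exact: (closed_comp (fun x _ => @norm_continuous _ R x) (@closed_le R _)).
- by near=> n; exact: le_part.
- exact: is_cvg_digit_series.
Unshelve. all: by end_near. Qed.

Lemma digit_sum_agree q b b' n : `|q| < 1 -> (forall k, (k < n)%N -> b k = b' k) ->
  `|digit_sum q b - digit_sum q b'| <= `|q| ^+ n * (2 / (1 - `|q|)).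
Proof.
move=> q1; elim: n b b' => [|n IH] b b' bb'.
  rewrite expr0 mul1r (le_trans (ler_normB _ _)) //.
  by rewrite mulr_natl mulr2n lerD ?digit_sum_bound.
rewrite (digit_sumS b q1) (digit_sumS b' q1) bb' // opprD addrACA subrr add0r.
rewrite -mulrBr normrM exprS -mulrA ler_wpM2l //.
by apply: IH => k kn; exact: bb'.
Qed.

End DigitSum.

(** * Eigen-coordinates on the torus *)

Section Golden.
Variable R : realType.

(** The golden ratio. *)
Definition phi : R := (1 + Num.sqrt 5) / 2.
(** The conjugate of the golden ratio, equal to - 1 / phi. *)
Definition psi : R := 1 - phi.

Lemma phi_sqr : phi * phi = phi + 1.
Proof.
have := @sqr_sqrtr R 5 (ler0n _ _); rewrite /phi expr2.
by move: (Num.sqrt 5) => x x5; field: x5.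
Qed.

Lemma phi_bounds : 8 / 5 < phi < 81 / 50.
Proof.
have := @sqr_sqrtr R 5 (ler0n _ _); have := sqrtr_ge0 (5 : R); rewrite /phi expr2.
by move: (Num.sqrt 5) => x x0 x5; apply/andP; split; nra.
Qed.

End Golden.

Section Coordinates.
Variable R : realType.
Local Notation phi := (phi R).
Local Notation psi := (psi R).
Implicit Types u t : R.

(** The class of the vector (a, b) with a phi + b = u and a psi + b = t. The factor
    (2 phi - 1) / 5 is the inverse of phi - psi, the square root of 5. *)
Definition torus_eigen u t : torus R :=
  (\pi_(circle R) ((u - t) * (2 * phi - 1) / 5),
   \pi_(circle R) ((phi * t - psi * u) * (2 * phi - 1) / 5)).

(** The coordinates of a point are determined up to the lattice of the pairs formed by
    an element of Z[phi] and its conjugate. *)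
Lemma torus_eigenP u t u' t' : torus_eigen u t = torus_eigen u' t' <->
  exists m n : int, u - u' = m%:~R + n%:~R * phi /\ t - t' = m%:~R + n%:~R * psi.
Proof.
have pp := phi_sqr R; rewrite /torus_eigen /psi; split.
  case=> /circle_piP[n En] /circle_piP[m Em]; exists m, n.
  by rewrite -En -Em; split; field: pp.
case=> m [n [Eu Et]]; have {Eu}-> : u = u' + (m%:~R + n%:~R * phi) by rewrite -Eu; ring.
have {Et}-> : t = t' + (m%:~R + n%:~R * (1 - phi)) by rewrite -Et; ring.
by congr pair; apply/circle_piP; [exists n|exists m]; field: pp.
Qed.

Lemma torus_map_eigen u t :
  torus_map fib_mx (torus_eigen u t) = torus_eigen (phi * u) (psi * t).
Proof.
have pp := phi_sqr R; rewrite torus_map_fib /torus_eigen /= -circle_piD /psi.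
by congr (\pi_(circle R) _, \pi_(circle R) _); field: pp.
Qed.

Lemma torus_eigen_surj (p : torus R) :
  exists u t, [/\ 0 <= u, `|t| <= 2 & torus_eigen u t = p].
Proof.
have pp := phi_sqr R; have /andP[p1 p2] := phi_bounds R.
case: p => a b.
have lift (c : circle R) : exists2 x : R, 0 <= x <= 1 & \pi_(circle R) x = c.
  have [x /= + <-] : (\pi_(circle R) @` `[0 : R, 1]) c by rewrite circle_pi_itv.
  by rewrite in_itv /=; exists x.
have [x /andP[x0 x1] <-] := lift a; have [y /andP[y0 y1] <-] := lift b.
exists (x * phi + y), (x * psi + y); split.
- by rewrite addr_ge0 // mulr_ge0 //; lra.
- by rewrite ler_norml /psi; apply/andP; split; nra.
by rewrite /torus_eigen /psi; congr (\pi_(circle R) _, \pi_(circle R) _); field: pp.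
Qed.

Lemma torus_eigen_ball u t t' e : `|t - t'| < e ->
  ball (torus_eigen u t) e (torus_eigen u t').
Proof.
have pp := phi_sqr R; have /andP[p1 p2] := phi_bounds R => tt'.
have small c : `|c| <= 1 -> `|c * (t - t')| < e.
  by move=> c1; rewrite normrM (le_lt_trans _ tt') // ler_piMl.
split; apply/circle_distP; do 2!eexists; split; try reflexivity.
  have -> : (u - t) * (2 * phi - 1) / 5 - (u - t') * (2 * phi - 1) / 5 =
    - ((2 * phi - 1) / 5) * (t - t') by field.
  by apply: small; rewrite ler_norml; apply/andP; split; lra.
have -> : (phi * t - psi * u) * (2 * phi - 1) / 5
    - (phi * t' - psi * u) * (2 * phi - 1) / 5 =
    ((phi + 2) / 5) * (t - t') by field: pp.
by apply: small; rewrite ler_norml; apply/andP; split; lra.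
Qed.

Lemma mem_states_of_bounds (m n : int) : `|m%:~R + n%:~R * phi| <= 1 ->
  `|m%:~R + n%:~R * psi| <= phi + 1 -> (m, n) \in states.
Proof.
have pp := phi_sqr R; have /andP[p1 p2] := phi_bounds R; rewrite /psi !ler_norml.
move=> /andP[h1 h2] /andP[h3 h4].
(* The difference of the two numbers is n (2 phi - 1), whence |n| < 2. *)
have n2 : -2 < n%:~R :> R by nra.
have n2' : n%:~R < 2 :> R by nra.
have m3 : -3 < m%:~R :> R by nra.
have m3' : m%:~R < 3 :> R by nra.
have {n2 n2'} : (-2 < n)%R && (n < 2)%R by rewrite -!(ltr_int R) n2 n2'.
have {m3 m3'} : (-3 < m)%R && (m < 3)%R by rewrite -!(ltr_int R) m3 m3'.
move=> hm hn.
have : m \in [:: -2; -1; 0; 1; 2] by rewrite !inE; lia.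
have : n \in [:: -1; 0; 1] by rewrite !inE; lia.
rewrite !inE => /or3P[] /eqP En /or4P[|||/orP[]] /eqP Em; move: h1 h2 h3 h4;
  rewrite Em En //; lra.
Qed.

End Coordinates.

(** * The code of a sequence of bits *)

Section Code.
Variable R : realType.
Local Notation phi := (phi R).
Local Notation psi := (psi R).
Implicit Types x y : full_shift bool.

Lemma phi_gt1 : 1 < phi.
Proof. by have /andP[] := phi_bounds R; lra. Qed.

Lemma norm_psi : `|psi| = phi - 1.
Proof.
have /andP[p1 p2] := phi_bounds R.
by rewrite ler0_norm /psi; lra.
Qed.

(** The sum of x(k) phi^(-k) over k >= 1; here phi - 1 = 1 / phi. *)
Definition unstable x : R := (phi - 1) * digit_sum (phi - 1) (fun k => x (k%:Z + 1)).
(** The sum of x(-k) psi^k over k >= 0. *)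
Definition stable x : R := digit_sum psi (fun k => x (- k%:Z)).

Lemma unstable_shift x : unstable (Defs.shift x) = phi * unstable x - (x 1)%:R.
Proof.
have pp := phi_sqr R; have /andP[p1 p2] := phi_bounds R.
have q1 : `|phi - 1| < 1 by rewrite ltr_norml; apply/andP; split; lra.
rewrite /unstable [digit_sum _ (fun k => x _)]digit_sumS // add0r.
have -> : (fun k : nat => x (k.+1%:Z + 1)) = (fun k => Defs.shift x (k%:Z + 1)).
  by apply/funext => k; rewrite /Defs.shift; congr x; lia.
by field: pp.
Qed.

Lemma stable_shift x : stable (Defs.shift x) = psi * stable x + (x 1)%:R.
Proof.
have /andP[p1 p2] := phi_bounds R.
have q1 : `|psi| < 1 by rewrite norm_psi; lra.
rewrite /stable digit_sumS // addrC /Defs.shift oppr0 add0r.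
congr (_ * digit_sum _ _ + _).
by apply/funext => k; congr x; lia.
Qed.

Lemma unstable_stable_bounded : exists2 M, forall x, `|unstable x| <= M &
  forall x, `|stable x| <= M.
Proof.
have /andP[p1 p2] := phi_bounds R.
have q1 : `|phi - 1| < 1 by rewrite ltr_norml; apply/andP; split; lra.
have q1' : `|psi| < 1 by rewrite norm_psi; lra.
exists (Num.max (1 - `|phi - 1|)^-1 (1 - `|psi|)^-1) => x; rewrite le_max.
  rewrite /unstable normrM (le_trans (ler_piMl _ (ltW q1))) ?normr_ge0 //.
  exact: digit_sum_bound.
by rewrite digit_sum_bound ?orbT.
Qed.

(** The [n]-th iterate of the shift, for an integer [n]. *)
Definition translate x (n : int) : full_shift bool := fun i => x (i + n).

Lemma shift_translate x n : Defs.shift (translate x n) = translate x (n + 1).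
Proof. by apply/funext => i; rewrite /Defs.shift /translate; congr x; lia. Qed.

Lemma translate0 x : translate x 0 = x.
Proof. by apply/funext => i; rewrite /translate addr0. Qed.

Lemma unstable_translate x n :
  unstable (translate x (n + 1)) = phi * unstable (translate x n) - (x (n + 1))%:R.
Proof. by rewrite -shift_translate unstable_shift /translate (addrC 1). Qed.

Lemma stable_translate x n :
  stable (translate x (n + 1)) = psi * stable (translate x n) + (x (n + 1))%:R.
Proof. by rewrite -shift_translate stable_shift /translate (addrC 1). Qed.

(** The admissible range of the unstable coordinate is [0, 1] if x(0) = 0 and
    [0, phi - 1] if x(0) = 1. An excess is multiplied by at least phi by the shift, and
    it is bounded, so there is none. *)
Lemma unstable_range x : golden_mean x -> 0 <= unstable x <= 1.
Proof.
move=> /golden_meanP gx; have pp := phi_sqr R; have /andP[p1 p2] := phi_bounds R.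
have [M uM _] := unstable_stable_bounded.
apply/andP; split.
  rewrite -oppr_le0 -{1}(translate0 x).
  apply: (@growth_le0 R phi M (fun k => - unstable (translate x k%:Z))) phi_gt1 _ _ => k.
    rewrite -[k.+1%:Z]/((1 + k)%N%:Z) PoszD addrC unstable_translate.
    by have : 0 <= (x (k%:Z + 1))%:R :> R by []; lra.
  by have := uM (translate x k%:Z); rewrite ler_norml => /andP[]; lra.
pose excess k := unstable (translate x k%:Z) - (1 - (x k%:Z)%:R * (2 - phi)).
have : excess 0%N <= 0.
  apply: (@growth_le0 R phi (M + 1)) phi_gt1 _ _ => k; rewrite /excess.
    rewrite -[k.+1%:Z]/((1 + k)%N%:Z) PoszD (addrC 1%:Z) unstable_translate.
    move: (unstable _) => v; have := gx k%:Z.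
    by case: (x k%:Z); case: (x (k%:Z + 1)) => nn; [by case: nn| | |];
      rewrite /= ?mulr1n ?mulr0n; nra.
  have := uM (translate x k%:Z); rewrite ler_norml => /andP[_].
  by case: (x k%:Z); rewrite /= ?mulr1n ?mulr0n; lra.
by rewrite /excess translate0; case: (x 0); rewrite /= ?mulr1n ?mulr0n; lra.
Qed.

(** The admissible range of the stable coordinate is [- 1, phi - 1] if x(0) = 0 and
    [phi - 1, phi] if x(0) = 1. The inverse of the shift exchanges excesses above and
    below, and multiplies them by at least phi. *)
Lemma stable_range x : golden_mean x -> - 1 <= stable x <= phi.
Proof.
move=> /golden_meanP gx; have pp := phi_sqr R; have /andP[p1 p2] := phi_bounds R.
have [M _ sM] := unstable_stable_bounded.
(* Excesses above and below the range, at time - k. *)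
pose hi k := stable (translate x (- k%:Z)) - (phi - 1 + (x (- k%:Z))%:R).
pose lo k := (phi * (x (- k%:Z))%:R - 1) - stable (translate x (- k%:Z)).
have : Num.max (hi 0%N) (lo 0%N) <= 0.
  apply: (@growth_le0 R phi (M + 3) (fun k => Num.max (hi k) (lo k))) phi_gt1 _ _ => k.
    have gxk := gx (- k.+1%:Z).
    have Es := stable_translate x (- k.+1%:Z).
    have Ek : - k.+1%:Z + 1 = - k%:Z by lia.
    rewrite Ek in gxk Es; rewrite /hi /lo Es /psi.
    move: (stable _) gxk => v.
    have pv : phi * phi * v = phi * v + v by rewrite pp; ring.
    rewrite maxr_pMr; last by lra.
    by case: (x (- k.+1%:Z)); case: (x (- k%:Z)) => nn; [by case: nn| | |];
      rewrite /= ?mulr1n ?mulr0n ge_max !le_max;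
      apply/andP; split; apply/orP; [right|left|right|left|right|left]; nra.
  have := sM (translate x (- k%:Z)); rewrite ler_norml /hi /lo => /andP[? ?].
  by rewrite ge_max; case: (x (- k%:Z)); rewrite /= ?mulr1n ?mulr0n; apply/andP; split; lra.
rewrite ge_max /hi /lo oppr0 translate0 => /andP[].
by case: (x 0); rewrite /= ?mulr1n ?mulr0n => ? ?; apply/andP; split; lra.
Qed.

(** The sign of the stable coordinate makes the shift act by subtracting x(1) from both
    coordinates, that is, by a vector of the lattice. *)
Definition golden_code x : torus R := torus_eigen (unstable x) (- stable x).

Lemma golden_code_shift x : golden_code (Defs.shift x) = torus_map fib_mx (golden_code x).
Proof.
rewrite /golden_code torus_map_eigen unstable_shift stable_shift.
apply/torus_eigenP; exists (- (x 1 : nat)%:Z), 0.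
by rewrite intrN -pmulrn; split; ring.
Qed.

End Code.

Arguments unstable R x : clear implicits.
Arguments stable R x : clear implicits.
Arguments golden_code R x : clear implicits.

(** * The kernel of the code *)

Lemma int_ind_iff (P : int -> Prop) :
  P 0 -> (forall n, P n <-> P (n + 1)) -> forall n, P n.
Proof.
move=> P0 PS; elim/int_rect => [//|n /PS|n Pn].
  by rewrite -[n.+1%:Z]/((1 + n)%N%:Z) PoszD addrC.
by apply/PS; have -> : - n.+1%:Z + 1 = - n%:Z by lia.
Qed.

Section Kernel.
Variable R : realType.
Local Notation phi := (phi R).
Local Notation psi := (psi R).
Implicit Types x y : full_shift bool.

Lemma golden_mean_translate x n : golden_mean x -> golden_mean (translate x n).
Proof.
move=> /golden_meanP gx; apply/golden_meanP => i; rewrite /translate.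
by rewrite addrAC; exact: gx.
Qed.

Lemma golden_code_translateS x n :
  golden_code R (translate x (n + 1)) = torus_map fib_mx (golden_code R (translate x n)).
Proof. by rewrite -shift_translate golden_code_shift. Qed.

Lemma golden_codeP x y : golden_code R x = golden_code R y <->
  exists m n : int, unstable R x - unstable R y = m%:~R + n%:~R * phi /\
    stable R y - stable R x = m%:~R + n%:~R * psi.
Proof.
rewrite torus_eigenP; split=> -[m [n [E1 E2]]]; exists m, n; split=> //.
  by rewrite -E2; ring.
by rewrite -E2; ring.
Qed.

(** If two sequences have the same code, so do all their shifts. The differences of the
    coordinates of these shifts are conjugate elements of Z[phi], which form a path of
    the automaton. *)
Lemma golden_code_eq_golden_rel x y : golden_mean x -> golden_mean y ->
  golden_code R x = golden_code R y -> golden_rel (pairing x y).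
Proof.
move=> gx gy cxy; have pp := phi_sqr R; have /andP[p1 p2] := phi_bounds R.
have ctrans : forall n, golden_code R (translate x n) = golden_code R (translate y n).
  apply: int_ind_iff; first by rewrite !translate0.
  move=> n; rewrite !golden_code_translateS; split=> [->//|].
  exact: can_inj (@torus_map_fibK R) _ _.
have /choice[st stP] n : exists z : state,
    unstable R (translate x n) - unstable R (translate y n) = z.1%:~R + z.2%:~R * phi /\
    stable R (translate y n) - stable R (translate x n) = z.1%:~R + z.2%:~R * psi.
  by have /golden_codeP[m [k H]] := ctrans n; exists (m, k).
apply: (@golden_rel_path x y st) => // n; split.
  have [E1 E2] := stP n; rewrite [st n]surjective_pairing.
  apply: (@mem_states_of_bounds R); rewrite -?E1 -?E2.
    have /andP[? ?] := unstable_range R (@golden_mean_translate x n gx).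
    have /andP[? ?] := unstable_range R (@golden_mean_translate y n gy).
    by rewrite ler_norml; apply/andP; split; lra.
  have /andP[? ?] := stable_range R (@golden_mean_translate x n gx).
  have /andP[? ?] := stable_range R (@golden_mean_translate y n gy).
  by rewrite ler_norml; apply/andP; split; lra.
have [E1 E2] := stP n; have [E3 E4] := stP (n + 1); move: E3 E4.
rewrite !unstable_translate !stable_translate /step /pairing /=.
case: (st (n + 1)) => m' k'; case: (st n) E1 E2 => m k /= E1 E2 E3 E4.
have D1 : m'%:~R + k'%:~R * phi =
    (k%:~R - ((x (n + 1))%:R - (y (n + 1))%:R)) + (m%:~R + k%:~R) * phi.
  rewrite -E3; have -> : unstable R (translate x n) =
    unstable R (translate y n) + (m%:~R + k%:~R * phi) by rewrite -E1; ring.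
  by ring: pp.
have D2 : m'%:~R + k'%:~R * psi =
    (k%:~R - ((x (n + 1))%:R - (y (n + 1))%:R)) + (m%:~R + k%:~R) * psi.
  rewrite -E4; have -> : stable R (translate y n) =
    stable R (translate x n) + (m%:~R + k%:~R * psi) by rewrite -E2; ring.
  by rewrite /psi; ring: pp.
(* Subtracting the two equations eliminates the rational part. *)
have k'E : k' = m + k.
  apply/eqP; rewrite -(eqr_int R) intrD -subr_eq0.
  have : (k'%:~R - (m%:~R + k%:~R)) * (2 * phi - 1) = 0 :> R.
    by move: D1 D2; rewrite /psi => D1 D2; lra.
  by move/eqP; rewrite mulf_eq0 => /orP[//|/eqP]; lra.
congr pair => //; apply/eqP; rewrite -(eqr_int R) !intrB !mulrz_nat; apply/eqP.
by move: D1; rewrite k'E intrD; lra.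
Qed.

(** Along a path of the automaton, the difference of the unstable coordinates and the
    state obey the same expanding recurrence, hence they are equal; likewise for the
    stable coordinates and the conjugate of the state, in the past. *)
Lemma golden_rel_golden_code_eq x y :
  golden_rel (pairing x y) -> golden_code R x = golden_code R y.
Proof.
move=> /state_seq[st stP]; have pp := phi_sqr R; have /andP[p1 p2] := phi_bounds R.
have [M uM sM] := unstable_stable_bounded R.
pose W n := unstable R (translate x n) - unstable R (translate y n)
   - ((st n).1%:~R + (st n).2%:~R * phi).
pose V n := stable R (translate y n) - stable R (translate x n)
   - ((st n).1%:~R + (st n).2%:~R * psi).
have stE n : (st (n + 1)).1%:~R = (st n).2%:~R - ((x (n + 1))%:R - (y (n + 1))%:R) :> R
    /\ (st (n + 1)).2%:~R = (st n).1%:~R + (st n).2%:~R :> R.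
  by rewrite (stP n).2 /step /pairing /= !intrB intrD !mulrz_nat.
have WS n : W (n + 1) = phi * W n.
  by rewrite /W !unstable_translate (stE n).1 (stE n).2; ring: pp.
have VS n : V (n + 1) = psi * V n.
  by rewrite /V !stable_translate (stE n).1 (stE n).2 /psi; ring: pp.
have st_bound n (c : R) : `|c| <= 2 -> `|(st n).1%:~R + (st n).2%:~R * c| <= 4.
  move=> c2; apply: le_trans (ler_normD _ _) _; rewrite normrM.
  have [m2 k1] : `|(st n).1%:~R| <= 2 :> R /\ `|(st n).2%:~R| <= 1 :> R.
    rewrite -!intr_norm -[2]/(2%:~R) -[1]/(1%:~R) !ler_int.
    have := (stP n).1; case: (st n) => m k; move: (m, k).
    have : all (fun z : state => (`|z.1| <= 2) && (`|z.2| <= 1)) states by [].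
    by move=> /allP al z /al/andP[].
  have : `|(st n).2%:~R| * `|c| <= 1 * 2 :> R by exact: ler_pM.
  by lra.
have W0 : W 0 = 0.
  apply: (@bounded_growth_eq0 R phi (M + M + 4) (fun k => W k%:Z)) (phi_gt1 R) _ _ => k.
    rewrite -[k.+1%:Z]/((1 + k)%N%:Z) PoszD addrC WS normrM ger0_norm //; lra.
  apply: le_trans (ler_normB _ _) _; apply: lerD; last first.
    by apply: st_bound; rewrite ler_norml; apply/andP; split; lra.
  by apply: le_trans (ler_normB _ _) _; rewrite lerD.
have V0 : V 0 = 0.
  rewrite -oppr0.
  apply: (@bounded_growth_eq0 R phi (M + M + 4) (fun k => V (- k%:Z))) (phi_gt1 R) _ _ => k.
    have := VS (- k.+1%:Z); have -> : - k.+1%:Z + 1 = - k%:Z by lia.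
    move=> ->; rewrite normrM norm_psi mulrA.
    have -> : phi * (phi - 1) = 1 by ring: pp.
    by rewrite mul1r.
  apply: le_trans (ler_normB _ _) _; apply: lerD; last first.
    by apply: st_bound; rewrite norm_psi; lra.
  by apply: le_trans (ler_normB _ _) _; rewrite lerD.
apply/golden_codeP; exists (st 0).1, (st 0).2.
move: W0 V0; rewrite /W /V !translate0 => W0 V0.
by split; apply: subr0_eq.
Qed.

End Kernel.

(** * Topology of the full shift and continuity of the code *)

Section FullShift.
Variable S : finType.

Lemma full_shift_compact : compact [set: full_shift S].
Proof.
have cS : compact [set: discrete_topology S].
  by apply: finite_compact; exact: (@finite_finset S).
have -> : [set: full_shift S] = [set f | forall i : int, [set: discrete_topology S] (f i)].
  by apply/seteqP; split.
exact: (@tychonoff int (fun=> discrete_topology S) (fun=> setT) (fun=> cS)).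
Qed.

Lemma near_coordinate (x : full_shift S) (i : int) : \forall y \near x, y i = x i.
Proof.
have := @proj_continuous int (fun=> discrete_topology S) i x.
by move=> /(_ [set a | a = x i]); apply; rewrite nbhs_principalE; apply/principal_filterP.
Qed.

Lemma near_coordinates (x : full_shift S) (f : nat -> int) (n : nat) :
  \forall y \near x, forall k, (k < n)%N -> y (f k) = x (f k).
Proof.
elim: n => [|n IH]; first by near=> y.
near=> y => k; rewrite ltnS leq_eqVlt => /orP[/eqP->|kn].
  by near: y; exact: near_coordinate.
by move: k kn; near: y.
Unshelve. all: by end_near. Qed.

End FullShift.

Lemma golden_mean_closed : closed golden_mean.
Proof.
rewrite -openC openE => x; rewrite /= => ngx.
have [i xi] : exists i, x i /\ x (i + 1).
  apply: contrapT => nxi; apply: ngx; apply/golden_meanP => i xi.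
  by apply: nxi; exists i.
have n1 := near_coordinate x i; have n2 := near_coordinate x (i + 1).
near=> y => /golden_meanP/(_ i); apply.
by rewrite (near n1 y) // (near n2 y).
Unshelve. all: by end_near. Qed.

(** A compact subset is compact as a space, for the initial topology. *)
Lemma compact_set_type (T : topologicalType) (A : set T) :
  compact A -> compact [set: A].
Proof.
move=> cA F PF _.
have FA : F (set_val @^-1` A).
  by apply: filterS (filterT : F setT) => y _; exact: set_valP.
have [x [Ax clx]] := cA (set_val @ F) _ FA.
exists (SigSub (mem_set Ax)); split=> // B U FB.
move=> [V [/= [W oW <-] WVx] WU].
have FB' : F (set_val @^-1` (set_val @` B)) by apply: filterS FB => y By; exists y.
have Wx : nbhs x W by apply: open_nbhs_nbhs; split.
have [z [[y By <-] Wy]] := clx _ _ FB' Wx.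
by exists y; split=> //; apply: WU.
Qed.

Section Continuity.
Variable R : realType.
Local Notation phi := (phi R).
Local Notation psi := (psi R).

Lemma digit_sum_continuous (q : R) (f : nat -> int) : `|q| < 1 ->
  continuous (fun x : full_shift bool => digit_sum q (fun k => x (f k))).
Proof.
move=> q1 x; apply/cvgrPdist_lt => e e0.
have [n ne] : exists n : nat, `|q| ^+ n * (2 / (1 - `|q|)) < e.
  have : (fun n => `|q| ^+ n * (2 / (1 - `|q|))) @ \oo --> (0 * (2 / (1 - `|q|)) : R).
    by apply: cvgMl; apply: cvg_expr; rewrite normr_id.
  rewrite mul0r => /cvgrPdist_lt/(_ e e0)[n _ /(_ n (leqnn n))] /=.
  by rewrite sub0r normrN => /(le_lt_trans (ler_norm _)); exists n.
near=> y; apply: le_lt_trans (digit_sum_agree q1 _) ne => k kn.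
by apply/esym; move: k kn; near: y; exact: near_coordinates.
Unshelve. all: by end_near. Qed.

Lemma torus_pair_continuous (T : topologicalType) (f g : T -> R) :
  continuous f -> continuous g ->
  continuous (fun x => (\pi_(circle R) (f x), \pi_(circle R) (g x)) : torus R).
Proof.
move=> cf cg x.
have cpi (h : T -> R) : continuous h -> continuous (fun x => \pi_(circle R) (h x)).
  by move=> ch y; apply: (continuous_comp (ch y)); exact: circle_pi_continuous.
exact: (@cvg_pair _ _ _ (nbhs x) _ _ _ _ _ _ _ (cpi _ cf x) (cpi _ cg x)).
Qed.

Lemma golden_code_continuous : continuous (golden_code R).
Proof.
have /andP[p1 p2] := phi_bounds R.
have cu : continuous (unstable R).
  move=> x; apply: cvgMr; apply: digit_sum_continuous.
  by rewrite ltr_norml; apply/andP; split; lra.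
have cs : continuous (stable R).
  by apply: digit_sum_continuous; rewrite norm_psi; lra.
apply: torus_pair_continuous => x; apply: cvgMl; apply: cvgMl.
  by apply: cvgB; [exact: cu|apply: cvgN; exact: cs].
apply: cvgB; apply: cvgMr; last exact: cu.
by apply: cvgN; exact: cs.
Qed.

End Continuity.

(** * Surjectivity of the code *)

Section Surjectivity.
Variable R : realType.
Local Notation phi := (phi R).
Local Notation psi := (psi R).

Lemma digit_sum0 (q : R) : `|q| < 1 -> digit_sum q (fun=> false) = 0.
Proof.
move=> q1; have := digit_sumS (fun=> false) q1; rewrite add0r => E.
have : digit_sum q (fun=> false) * (1 - q) = 0 by rewrite mulrBr mulr1 mulrC -E subrr.
move/eqP; rewrite mulf_eq0 => /orP[/eqP//|]; rewrite subr_eq0 => /eqP q1'.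
by move: q1; rewrite -q1' normr1 ltxx.
Qed.

(** Greedy expansion of u in base phi, with zeros at all positions up to 0. *)
Lemma golden_expansion (u : R) : 0 <= u < 1 ->
  exists2 x, golden_mean x & golden_code R x = torus_eigen u 0.
Proof.
move=> /andP[u0 u1]; have pp := phi_sqr R; have /andP[p1 p2] := phi_bounds R.
pose T (r : R) := phi * r - (1 <= phi * r :> R)%R%:R.
(* The remainders of the expansion; the digit at n + 1 is the integer part of phi r(n). *)
pose r n := iter n T u.
have r01 n : 0 <= r n < 1.
  elim: n => [|n /andP[r0 r1]]; first by rewrite /r /= u0.
  rewrite /r iterS -/(r n) /T; case: (lerP 1 (phi * r n)) => h /=.
    by apply/andP; split; rewrite ?mulr1n; nra.
  by rewrite subr0 h mulr_ge0 //; lra.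
pose x : full_shift bool := fun i => if i is Posz n.+1 then 1 <= phi * r n else false.
have rS n : r n.+1 = phi * r n - (x (n%:Z + 1))%:R.
  by have -> : n%:Z + 1 = n.+1%:Z by lia.
exists x.
  apply/golden_meanP => -[[|n]|[|n]] [] //.
  have -> : n.+1%:Z + 1 = n.+2%:Z by lia.
  rewrite /x /r iterS -/(r n) /T => h; rewrite h /=; have /andP[_ r1] := r01 n.
  by rewrite mulr1n; nra.
have [M uM _] := unstable_stable_bounded R.
(* The unstable coordinates and the remainders obey the same recurrence. *)
pose W n := unstable R (translate x n%:Z) - r n.
have W0 : W 0%N = 0.
  apply: (@bounded_growth_eq0 R phi (M + 1)) (phi_gt1 R) _ _ => n.
    have -> : W n.+1 = phi * W n.
      rewrite /W rS -[n.+1%:Z]/((1 + n)%N%:Z) PoszD (addrC 1%:Z) unstable_translate.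
      by ring.
    by rewrite normrM ger0_norm //; lra.
  apply: le_trans (ler_normB _ _) _; rewrite lerD // ger0_norm.
    by have /andP[_ /ltW] := r01 n.
  by have /andP[] := r01 n.
rewrite /golden_code; congr torus_eigen.
  by apply: subr0_eq; rewrite -{1}(translate0 x).
have -> : stable R x = digit_sum psi (fun=> false).
  by congr digit_sum; apply/funext => -[|n].
by rewrite digit_sum0 ?oppr0 // norm_psi; lra.
Qed.

Lemma golden_code_iter n p :
  (exists2 x, golden_mean x & golden_code R x = p) ->
  exists2 x, golden_mean x & golden_code R x = iter n (torus_map fib_mx) p.
Proof.
case=> x gx <-; elim: n => [|n [y gy Ey]]; first by exists x.
exists (Defs.shift y); last by rewrite golden_code_shift Ey.
exact: sft_shift.
Qed.

Lemma iter_torus_map_eigen n (u t : R) :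
  iter n (torus_map fib_mx) (torus_eigen u t) = torus_eigen (phi ^+ n * u) (psi ^+ n * t).
Proof.
elim: n => [|n IH]; first by rewrite !expr0 !mul1r.
by rewrite iterS IH torus_map_eigen !exprS !mulrA.
Qed.

Lemma golden_code_half_line (u : R) : 0 <= u ->
  exists2 x, golden_mean x & golden_code R x = torus_eigen u 0.
Proof.
move=> u0; have /andP[p1 p2] := phi_bounds R.
have [n un] : exists n, u < phi ^+ n.
  apply: contrapT => nu.
  have : (fun n => phi ^+ n) 0%N <= 0.
    apply: (@growth_le0 R phi u (fun n => phi ^+ n)) (phi_gt1 R) _ _ => n.
      by rewrite exprS.
    by rewrite leNgt; apply/negP => h; apply: nu; exists n.
  by rewrite expr0; lra.
have pn : 0 < phi ^+ n by rewrite exprn_gt0 //; lra.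
have -> : torus_eigen u 0 = iter n (torus_map fib_mx) (torus_eigen (u / phi ^+ n) 0).
  by rewrite iter_torus_map_eigen mulr0 mulrC divfK // gt_eqF.
apply/golden_code_iter/golden_expansion.
by rewrite divr_ge0 ?(ltW pn) // ltr_pdivrMr // mul1r.
Qed.

Lemma golden_mean_compact : compact golden_mean.
Proof. exact: subclosed_compact golden_mean_closed (@full_shift_compact _) _. Qed.

(** The codes form a closed set which contains the image of the half-line t = 0, u >= 0.
    This image is dense: the [n]-th preimage of p has coordinates u >= 0 and |t| <= 2, and
    its [n]-th image is within 2 |psi|^n of the half-line. *)
Lemma golden_code_surjective (p : torus R) :
  exists2 x, golden_mean x & golden_code R x = p.
Proof.
have /andP[p1 p2] := phi_bounds R.
suff : closure (golden_code R @` golden_mean) p.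
  rewrite -(closure_id _).1; first by case=> x gx <-; exists x.
  apply: (compact_closed (@torus_hausdorff R)); apply: continuous_compact.
    exact/continuous_subspaceT/golden_code_continuous.
  exact: golden_mean_compact.
move=> B /(@nbhs_ballP R (torus R)) [e /= e0 eB].
have [n ne] : exists n : nat, 2 * `|psi| ^+ n < e.
  have : (fun n => 2 * `|psi| ^+ n) @ \oo --> (2 * 0 : R).
    by apply: cvgMr; apply: cvg_expr; rewrite normr_id norm_psi; lra.
  rewrite mulr0 => /cvgrPdist_lt/(_ e e0)[n _ /(_ n (leqnn n))] /=.
  by rewrite sub0r normrN => /(le_lt_trans (ler_norm _)); exists n.
have [u [t [u0 t2 Eut]]] := torus_eigen_surj (iter n (@torus_fib_inv R) p).
have Ep : p = torus_eigen (phi ^+ n * u) (psi ^+ n * t).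
  rewrite -iter_torus_map_eigen Eut.
  by elim: n {ne Eut} => [//|n IH]; rewrite iterSr iterS torus_fib_invK.
have un0 : 0 <= phi ^+ n * u by rewrite mulr_ge0 // exprn_ge0 //; lra.
have [x gx Ex] := golden_code_half_line un0.
exists (golden_code R x); split; first by exists x.
apply: eB; rewrite Ep Ex; apply: torus_eigen_ball.
rewrite subr0 normrM normrX mulrC (le_lt_trans _ ne) //.
by rewrite ler_wpM2r // exprn_ge0.
Qed.

End Surjectivity.

(** * The conjugacy *)

Section Conjugacy.
Variable R : realType.

Local Notation X := (sft golden_mean_words).

(** The relation K, introduced as the kernel of the code. *)
Definition code_rel (x y : X) : bool :=
  `[< golden_code R (\val x) = golden_code R (\val y) >].

Lemma code_rel_refl : reflexive code_rel.
Proof. by move=> x; apply/asboolP. Qed.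

Lemma code_rel_sym : symmetric code_rel.
Proof. by move=> x y; apply/asboolP/asboolP => ->. Qed.

Lemma code_rel_trans : transitive code_rel.
Proof. by move=> y x z /asboolP xy /asboolP yz; apply/asboolP; rewrite xy. Qed.

Canonical code_equiv := EquivRel code_rel code_rel_refl code_rel_sym code_rel_trans.

Local Notation Q := (quotient_topology {eq_quot code_equiv}).

Lemma code_pi (x y : X) :
  \pi_Q x = \pi_Q y <-> golden_code R (\val x) = golden_code R (\val y).
Proof.
split=> [/(@eqmodP _ code_equiv) /asboolP //|xy].
by apply/(@eqmodP _ code_equiv)/asboolP.
Qed.

(** The map from X/K to the torus induced by the code. *)
Definition quotient_code (a : Q) : torus R := golden_code R (\val (repr a)).

Lemma quotient_code_pi (x : X) : quotient_code (\pi_Q x) = golden_code R (\val x).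
Proof. by apply/code_pi; rewrite reprK. Qed.

Lemma quotient_code_continuous : continuous quotient_code.
Proof.
apply/quotient_continuous.
have -> : quotient_code \o \pi_Q = golden_code R \o (fun x : X => \val x).
  by apply/funext => x; exact: quotient_code_pi.
move=> x; apply: continuous_comp; last exact: golden_code_continuous.
exact: initial_continuous.
Qed.

Lemma quotient_code_bij : exists d : torus R -> Q,
  cancel quotient_code d /\ cancel d quotient_code.
Proof.
have /choice[d dP] (p : torus R) : exists a : Q, quotient_code a = p.
  have [x gx <-] := golden_code_surjective p.
  by exists (\pi_Q (SigSub (mem_set gx) : X)); rewrite quotient_code_pi.
exists d; split=> // a.
rewrite -[LHS]reprK -[RHS]reprK; apply/code_pi.
exact: dP.
Qed.

Lemma code_quotient_compact : compact [set: Q].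
Proof.
have -> : [set: Q] = \pi_Q @` [set: X].
  by apply/seteqP; split=> // a _; exists (repr a) => //; rewrite reprK.
apply: continuous_compact.
  exact/continuous_subspaceT/pi_continuous.
exact: compact_set_type golden_mean_compact.
Qed.

Lemma golden_quotient_conjugate :
  quotient_conjugate (torus_map fib_mx : torus R -> torus R) golden_mean_words golden_rel.
Proof.
exists code_equiv; split.
  move=> x y; have gx := set_valP x; have gy := set_valP y.
  split=> [/asboolP|xy]; first exact: golden_code_eq_golden_rel.
  by apply/asboolP; exact: golden_rel_golden_code_eq.
have [d [codeK dK]] := quotient_code_bij.
have cd : continuous d.
  exact: compact_hausdorff_inverse code_quotient_compact (@torus_hausdorff R)
    codeK dK quotient_code_continuous.
have comp3 (f : torus R -> torus R) : continuous f ->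
    continuous (d \o f \o quotient_code).
  move=> cf a; apply: continuous_comp; first exact: quotient_code_continuous.
  by apply: continuous_comp; [exact: cf|exact: cd].
exists (d \o torus_map fib_mx \o quotient_code); split.
- exists (d \o @torus_fib_inv R \o quotient_code); split.
  + by move=> a /=; rewrite dK torus_map_fibK codeK.
  + by move=> a /=; rewrite dK torus_fib_invK codeK.
  + exact: comp3 (@torus_map_fib_continuous R).
  + exact: comp3 (@torus_fib_inv_continuous R).
- move=> x; rewrite /= quotient_code_pi -golden_code_shift.
  by rewrite -[RHS]codeK quotient_code_pi.
exists d; last by move=> p /=; rewrite dK.
by exists quotient_code; split=> //; exact: quotient_code_continuous.
Qed.

End Conjugacy.

Theorem theorem1p12 (R : realType) :
  [/\ expansive (torus_map fib_mx : torus R -> torus R),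
      SFT_SFT (torus_map fib_mx : torus R -> torus R),
      quotient_conjugate (torus_map fib_mx : torus R -> torus R) golden_mean_words golden_rel,
      minimal_forbidden golden_mean = [set [:: true; true]] &
      minimal_forbidden golden_rel = [set` golden_rel_words] `|` component11].
Proof.
split.
- exact: torus_map_fib_expansive.
- exists bool, golden_mean_words, golden_rel_words.
  exact: golden_quotient_conjugate.
- exact: golden_quotient_conjugate.
- exact: golden_mean_minimal.
- exact: golden_rel_minimal.
Qed.
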